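(* For each $p\in\mathbb{N}$ consider the grid road network with vertex set $\mathcal{V}_p=\{0,\dots,p\}^2$ and segment set $\mathcal{S}_p$ of directed edges between vertices at $\ell_1$-distance $1$; $\mathcal{Y}_p$ is the set of possible routes (each a set of at least one segment). Let $0<\alpha\le1$ and let the route distribution $\mu_p$ be: origin $x_1$ and destination $x_2$ independent, each with $\mathbb{P}[X=(i,j)]=\prod_{k\in\{i,j\}}\binom{p}{k}B(\alpha+k,\alpha+p-k)/B(\alpha,\alpha)$; given $(x_1,x_2)$ the route is drawn uniformly among the routes from $x_1$ to $x_2$ whose number of segments equals $\|x_1-x_2\|_1$ and which have the minimum possible number of turns. The $N=N(p)\to\infty$ historical routes and the predicting route $Y_p$ are i.i.d. from $\mu_p$. For each trip $n$ and segment $s$ of its route, $T'_{n,s}=\theta_s+\varepsilon_{n,s}$, where the $\theta_s$ are i.i.d. with mean $\mu$ and variance $\tau^2>0$; within a trip the errors have mean $0$ and covariance $\sigma_{s,t}$; errors of distinct trips are independent; and the errors together with $\theta$ are jointly Gaussian. The matrices $\Sigma_p=[\sigma_{s,t}]_{s,t\in\mathcal{S}_p}$ and $\Psi_p=\Sigma_p^{-1}=[\psi_{s,t}]$ satisfy $\sum_{t}|\sigma_{s,t}|=\mathcal{O}(1)$ and $\sum_t|\psi_{s,t}|=\mathcal{O}(1)$ uniformly in $s$ and $p$, and there is $\sigma_{\min}>0$ with $\sum_{s,t\in y}\sigma_{s,t}\ge\sigma_{\min}$ for every route $y\in\mathcal{Y}_p$. (1) If $1/2\le\alpha\le1$ and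 $N=\omega(p)$, then for any segment-based estimator $\hat\Theta^{(\mathrm{seg})}$ with $\phi_s(N_s)=1-\mathcal{O}(1/\sqrt{N_s})$ for all $s\in\mathcal{S}_p$, $$\frac{R(\hat\Theta^{(\mathrm{seg})}_{Y_p})}{R(\hat\Theta^\ast_{Y_p})}=\mathcal{O}(\log p),$$ where $\hat\Theta^\ast_{Y_p}$ is the optimal (integrated-risk-minimizing) estimator. (2) If $N=\mathcal{O}(p)$, then $\liminf_{p\to\infty}R(\hat\Theta_{Y_p})>0$ for any estimator $\hat\Theta$.
   Context: $B(\cdot,\cdot)$ is the beta function. Integrated risk: $R(\hat\Theta_{Y_p})=\mathbb{E}[(\hat\Theta_{Y_p}-\sum_{s\in Y_p}\theta_s)^2]$, expectation over historical routes, predicting route, travel times and the prior of $\theta$. The optimal estimator $\hat\Theta^\ast_{Y_p}$ is the posterior mean of $\sum_{s\in Y_p}\theta_s$ given all observed historical travel times and routes. $N_s$ is the number of historical trips traversing $s$; convention $0/0=0$. A segment-based estimator for route $y$ is $\sum_{s\in y}[(1-\phi_s(N_s))\mu+\phi_s(N_s)\sum_{n:s\in Y_{p,n}}T'_{n,s}/N_s]$ with $\phi_s:\mathbb{Z}_{\ge0}\to\mathbb{R}$, $\phi_s(0)=0$. $\mathcal{O},\Omega,\omega$ are the usual asymptotic notations as $p\to\infty$.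
   Formalization: Origin and destination are conditioned on being distinct, since for x_1=x_2 (positive probability) no route with at least one segment has length 0 and the route law is undefined; θ, the errors and the routes are taken mutually independent. *)

(* Defs.v *)
From HB Require Import structures.
From mathcomp Require Import all_boot all_order all_algebra.
From mathcomp Require Import all_classical all_reals all_analysis.
From mathcomp Require Import normal_distribution.
Set Implicit Arguments.
Unset Strict Implicit.
Unset Printing Implicit Defensive.
Import Order.TTheory GRing.Theory Num.Theory.
Import numFieldNormedType.Exports.
Local Open Scope classical_set_scope.
Local Open Scope ring_scope.

Definition vtx (p : nat) : finType := ('I_p.+1 * 'I_p.+1)%type.

Definition distn (a b : nat) : nat := (a - b) + (b - a).

Definition l1dist (p : nat) (u v : vtx p) : nat :=
  distn u.1 v.1 + distn u.2 v.2.

Definition adjb (p : nat) (e : vtx p * vtx p) : bool := l1dist e.1 e.2 == 1%N.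

Definition seg (p : nat) : finType := {e : vtx p * vtx p | adjb e}.

Definition is_path (p : nat) (x : vtx p) (vs : seq (vtx p)) : bool :=
  path (fun u v => adjb (u, v)) x vs.

Definition path_segs (p : nat) (x : vtx p) (vs : seq (vtx p)) : {set seg p} :=
  [set s : seg p | val s \in zip (x :: vs) vs].

Definition is_route (p : nat) (y : {set seg p}) : Prop :=
  exists (x : vtx p) (vs : seq (vtx p)),
    [/\ (0 < size vs)%N, is_path x vs, uniq (x :: vs) & y = path_segs x vs].

Definition dir (p : nat) (u v : vtx p) : int * int :=
  ((v.1 : nat)%:Z - (u.1 : nat)%:Z, (v.2 : nat)%:Z - (u.2 : nat)%:Z)%R.

Definition turns (p : nat) (x : vtx p) (vs : seq (vtx p)) : nat :=
  let ds := [seq dir e.1 e.2 | e <- zip (x :: vs) vs] in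
  count (fun e => e.1 != e.2) (zip ds (behead ds)).

Definition shortest (p : nat) (x1 x2 : vtx p)
    (vs : (l1dist x1 x2).-tuple (vtx p)) : bool :=
  is_path x1 vs && (last x1 vs == x2).

Definition min_turn (p : nat) (x1 x2 : vtx p)
    (vs : (l1dist x1 x2).-tuple (vtx p)) : bool :=
  shortest vs &&
  [forall ws : (l1dist x1 x2).-tuple (vtx p),
     shortest ws ==> (turns x1 vs <= turns x1 ws)%N].

Definition mt_routes (p : nat) (x1 x2 : vtx p) : {set {set seg p}} :=
  [set path_segs x1 (val vs) | vs in [pred vs : (l1dist x1 x2).-tuple (vtx p) | min_turn vs]].

Section RouteLaw.
Variable R : realType.

Definition betaR (a b : R) : R :=
  Rintegral lebesgue_measure `]0%R, 1%R[
    (fun x : R => x `^ (a - 1) * (1 - x) `^ (b - 1)).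

Definition coord_law (alpha : R) (p k : nat) : R :=
  'C(p, k)%:R * betaR (alpha + k%:R) (alpha + (p - k)%:R) / betaR alpha alpha.

Definition vtx_law (alpha : R) (p : nat) (x : vtx p) : R :=
  coord_law alpha p x.1 * coord_law alpha p x.2.

(* mu_p(y): origin and destination independent with law vtx_law, conditioned
   on being distinct (so that the route has at least one segment), then the
   route uniform among mt_routes x1 x2. *)
Definition route_law (alpha : R) (p : nat) (y : {set seg p}) : R :=
  (\sum_(x1 : vtx p) \sum_(x2 : vtx p | x1 != x2)
      vtx_law alpha x1 * vtx_law alpha x2 *
      ((y \in mt_routes x1 x2)%:R / #|mt_routes x1 x2|%:R))
  / (1 - \sum_(x : vtx p) vtx_law alpha x ^+ 2).

Definition gauss_law (m v : R) : set R -> \bar R :=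
  if v == 0 then @dirac _ R m R else normal_prob m (Num.sqrt v).

End RouteLaw.

Definition route_cfg (p N : nat) : finType := {ffun 'I_N -> {set seg p}}.

Section Model.
Variables (R : realType) (p N : nat).
Variables (d : measure_display) (T : measurableType d) (P : probability T R).
Variables (Yh : 'I_N -> T -> {set seg p}) (Y : T -> {set seg p}).
Variables (theta : T -> seg p -> R) (eps : 'I_N -> T -> seg p -> R).

(* the joint law: historical routes Yh n and predicting route Y are i.i.d.
   mu_p, independent of the Gaussian vector (theta, eps_0, ..., eps_{N-1}),
   where theta_s are i.i.d. N(mu, tau2), each eps_n is N(0, Sigma) and the
   blocks theta, eps_0, ..., eps_{N-1} are independent.  Joint Gaussianity is
   expressed via all linear functionals (Cramer-Wold), jointly with the
   routes. *)
Definition trip_model (alpha mu tau2 : R) (Sigma : seg p -> seg p -> R) : Prop :=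
  [/\ (forall n y, measurable [set w | Yh n w = y]),
      (forall y, measurable [set w | Y w = y]),
      (forall s, measurable_fun [set: T] (fun w => theta w s)),
      (forall n s, measurable_fun [set: T] (fun w => eps n w s)) &
      forall (ys : route_cfg p N) (y : {set seg p})
             (u : seg p -> R) (v : 'I_N -> seg p -> R) (B : set R),
        measurable B ->
        P ([set w | (forall n, Yh n w = ys n) /\ Y w = y] `&`
           ((fun w => \sum_s u s * theta w s +
                      \sum_(n < N) \sum_s v n s * eps n w s) @^-1` B))
        = (((\prod_(n < N) route_law alpha (ys n)) * route_law alpha y)%:E *
           gauss_law (mu * \sum_s u s)
                     (tau2 * \sum_s u s ^+ 2 +
                      \sum_(n < N) \sum_s \sum_t v n s * Sigma s t * v n t) B)%E].

Definition cfg_of (w : T) : route_cfg p N := [ffun n => Yh n w].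

(* observed travel times T'_{n,s} = theta_s + eps_{n,s} for s on the route of
   trip n (coordinates off the route are set to 0, carrying no information) *)
Definition data (w : T) : N.-tuple (#|seg p|.-tuple R) :=
  [tuple [tuple (let s := enum_val j in
                 if s \in Yh n w then theta w s + eps n w s else 0)
          | j < #|seg p|] | n < N].

Definition risk
    (est : route_cfg p N -> {set seg p} -> N.-tuple (#|seg p|.-tuple R) -> R)
    : \bar R :=
  (\int[P]_w ((est (cfg_of w) (Y w) (data w) - \sum_(s in Y w) theta w s) ^+ 2)%:E)%E.

Definition opt_risk : \bar R :=
  ereal_inf [set risk est |
    est in [set est : route_cfg p N -> {set seg p} ->
                      N.-tuple (#|seg p|.-tuple R) -> R |
            forall ys y, measurable_fun [set: N.-tuple (#|seg p|.-tuple R)] (est ys y)]].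

End Model.

Definition seg_est (R : realType) (p N : nat) (mu : R) (phi : seg p -> nat -> R)
    (ys : route_cfg p N) (y : {set seg p}) (D : N.-tuple (#|seg p|.-tuple R)) : R :=
  \sum_(s in y)
    (let Ns := #|[set n : 'I_N | s \in ys n]| in
     (1 - phi s Ns) * mu +
     phi s Ns * ((\sum_(n < N | s \in ys n) tnth (tnth D n) (enum_rank s)) / Ns%:R)).

(* Main.v *)
(* Condition on all routes, write N_s for the number of historical trips through
   s, and let U be the sum over s in Y of 1 / (1 + tau^2 C N_s), with C bounding
   the rows of Psi.  Both risks are comparable to U.

   Upper bound.  The error of a segment-based estimator is a centered linear
   functional of the Gaussian vector, and a Schur bound on the rows of Sigma
   makes its variance O(U).

   Lower bound.  Take Z = sum_s a_s (theta_s - mu) + sum_n <b_n, eps_n> with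
   a_s = 1_{s in Y} / (1 + tau^2 C N_s) and b_n = - tau^2 Psi (a 1_{Y_n}).  It is
   uncorrelated with the data, has variance at most tau^2 U, and its covariance
   with the target is tau^2 U.  The Gaussian reflection along Z preserves the law
   and the data but displaces the target, so the parallelogram identity bounds
   the risk of every estimator below by a multiple of U.  Equality of the joint
   laws comes from the one-dimensional ones by Cramer-Wold: an iteration of the
   polynomial (3y - y^3)/2 turns sin into a square wave, hence indicators of boxes
   into bounded limits of trigonometric polynomials.

   So the ratio in (1) is even O(1).  For (2), N_s <= N = O(p), while the mean
   route length is of order p because the beta distribution is not a Dirac mass. *)

Require Import Defs.
From HB Require Import structures.
From mathcomp Require Import all_boot all_order all_algebra.
From mathcomp Require Import all_classical all_reals all_analysis.
From mathcomp Require Import measurable_realfun normal_distribution.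
From mathcomp Require Import ring lra zify.
Set Implicit Arguments.
Unset Strict Implicit.
Unset Printing Implicit Defensive.

Import Order.TTheory GRing.Theory Num.Theory.
Import numFieldNormedType.Exports.
Local Open Scope classical_set_scope.
Local Open Scope ring_scope.

(** * Bounded limits of trigonometric polynomials *)

(* The functions whose expectation is determined by the laws of the linear
   functionals. *)
Inductive trig_limit (R : realType) (I : finType) : ((I -> R) -> R) -> Prop :=
| trig_limit_cos (t : I -> R) (b : R) :
    trig_limit (fun x => cos (\sum_i t i * x i + b))
| trig_limit_lin (a b : R) (F G : (I -> R) -> R) :
    trig_limit F -> trig_limit G ->
    trig_limit (fun x => a * F x + b * G x)
| trig_limit_lim (F : nat -> (I -> R) -> R) (G : (I -> R) -> R) (M : R) :
    (forall n, trig_limit (F n)) -> (forall n x, `|F n x| <= M) ->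
    (forall x, F n x @[n --> \oo] --> G x) -> trig_limit G.

Section TrigLimit.
Variables (R : realType) (I : finType).
Implicit Types (F G : (I -> R) -> R) (B : set (I -> R)).

Lemma trig_limit_eq F G : F =1 G -> trig_limit F -> trig_limit G.
Proof. by move=> /funext ->. Qed.

Lemma trig_limit_cst (c : R) : trig_limit (fun _ : I -> R => c).
Proof.
apply: trig_limit_eq
  (trig_limit_lin c 0 (trig_limit_cos (fun _ : I => 0) 0)
     (trig_limit_cos (fun _ : I => 0) 0)) => x /=.
rewrite big1 ?add0r ?cos0 ?mulr1 ?mul0r ?addr0// => i _.
by rewrite mul0r.
Qed.

(** The bound serves twice: it lets a fixed factor be multiplied into a bounded limit, and it makes
    trigonometric limits integrable on an event. *)
Lemma trig_limit_bounded F : trig_limit F -> exists M : R, forall x, `|F x| <= M.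
Proof.
elim=> [t b|a b {}F G _ [M HM] _ [M' HM']|F' G M _ _ HM HG].
- by exists 1 => x; rewrite ler_norml cos_geN1 cos_le1.
- exists (`|a| * M + `|b| * M') => x.
  rewrite (le_trans (ler_normD _ _))// !normrM.
  by apply: lerD; apply: ler_wpM2l.
- exists M => x.
  have h : `|F' n x| @[n --> \oo] --> `|G x| by apply: cvg_norm; exact: HG.
  rewrite -(cvg_lim _ h)//; apply: limr_le; first by apply/cvg_ex; exists `|G x|.
  by apply: nearW => n; exact: HM.
Qed.

(** Double induction, first on [G], then on [F] against a single cosine. Two cosines are handled by
    the product-to-sum formula, and in the limit cases boundedness of the other factor keeps the
    products uniformly bounded. *)
Lemma trig_limit_mul F G :
  trig_limit F -> trig_limit G -> trig_limit (fun x => F x * G x).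
Proof.
move=> hF; elim=> [t b|a b G1 G2 _ h1 _ h2|G' G0 M _ h HM HG]; last first.
- have [M' HM'] := trig_limit_bounded hF.
  apply: (@trig_limit_lim _ _ (fun n x => F x * G' n x) _ (M' * M)) => //.
  + by move=> n x; rewrite normrM; apply: ler_pM.
  + by move=> x; apply: cvgMl_tmp; exact: HG.
- by apply: trig_limit_eq (trig_limit_lin a b h1 h2) => x /=; ring.
elim: {F} hF => [s c|a c F1 F2 _ h1 _ h2|F F0 M _ h HM HF].
- apply: trig_limit_eq (trig_limit_lin 2^-1 2^-1
    (trig_limit_cos (fun i => s i + t i) (c + b))
    (trig_limit_cos (fun i => s i - t i) (c - b))) => x /=.
  have -> : \sum_i (s i + t i) * x i + (c + b) =
            (\sum_i s i * x i + c) + (\sum_i t i * x i + b).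
    by under eq_bigr do rewrite mulrDl; rewrite big_split/=; ring.
  have -> : \sum_i (s i - t i) * x i + (c - b) =
            (\sum_i s i * x i + c) - (\sum_i t i * x i + b).
    by under eq_bigr do rewrite mulrBl; rewrite sumrB; ring.
  by rewrite cosB cosD; field.
- by apply: trig_limit_eq (trig_limit_lin a c h1 h2) => x /=; ring.
- apply: (@trig_limit_lim _ _ (fun n x => F n x * cos (\sum_i t i * x i + b)) _ M) => //.
  + move=> n x; rewrite normrM -[leRHS]mulr1; apply: ler_pM => //.
    by rewrite ler_norml cos_geN1 cos_le1.
  + by move=> x; apply: cvgMr_tmp; exact: HF.
Qed.

(* One step of the Newton-Schulz iteration for the sign function. *)
Definition sgn_step (y : R) : R := (3 * y - y ^+ 3) / 2.

Lemma sgn_stepN y : sgn_step (- y) = - sgn_step y.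
Proof. by rewrite /sgn_step; field. Qed.

Lemma iter_sgn_stepN n y : iter n sgn_step (- y) = - iter n sgn_step y.
Proof. by elim: n => //= n ->; rewrite sgn_stepN. Qed.

(** At an iterate z in [y, 1] the gap 1 - z is multiplied by (1 - z)(2 + z)/2 = 1 - z/2 - z^2/2,
    which is at most 1 - y/2. Iterates increase, so this rate stays valid and convergence is
    geometric. *)
Lemma iter_sgn_step_gt0 n y : 0 < y <= 1 ->
  y <= iter n sgn_step y <= 1 /\ 1 - iter n sgn_step y <= (1 - y / 2) ^+ n.
Proof.
move=> /andP[y0 y1]; elim: n => [|n [/andP[h1 h2] h3]] /=.
  by rewrite lexx y1 expr0; split => //; lra.
set z := iter n sgn_step y in h1 h2 h3 *.
have z0 : 0 < z by lra.
have E : 1 - sgn_step z = (1 - z) * ((1 - z) * (2 + z) / 2).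
  by rewrite /sgn_step; field.
have E2 : sgn_step z - z = z * (1 - z) * (1 + z) / 2.
  by rewrite /sgn_step; field.
split.
  apply/andP; split.
    suff : 0 <= sgn_step z - z by lra.
    by rewrite E2 divr_ge0// !mulr_ge0//; lra.
  suff : 0 <= 1 - sgn_step z by lra.
  by rewrite E mulr_ge0 ?divr_ge0 ?mulr_ge0//; lra.
rewrite E exprSr ler_pM//; first lra.
  by rewrite divr_ge0 ?mulr_ge0//; lra.
nra.
Qed.

Lemma iter_sgn_step_le1 n y : `|y| <= 1 -> `|iter n sgn_step y| <= 1.
Proof.
have [y0|y0|->] := ltgtP y 0 => hy; last first.
- have -> : iter n sgn_step 0 = 0.
    by elim: n => //= n ->; rewrite /sgn_step mulr0 expr0n/= subr0 mul0r.
  by rewrite normr0.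
- have [|/andP[h1 h2] _] := @iter_sgn_step_gt0 n y.
    by rewrite y0/=; rewrite gtr0_norm in hy.
  by rewrite ger0_norm//; lra.
- have [|/andP[h1 h2] _] := @iter_sgn_step_gt0 n (- y).
    by rewrite ltr0_norm in hy => //; rewrite oppr_gt0 y0.
  by rewrite -[y]opprK iter_sgn_stepN normrN ger0_norm//; lra.
Qed.

Lemma cvg_iter_sgn_step y : `|y| <= 1 ->
  iter n sgn_step y @[n --> \oo] --> Num.sg y.
Proof.
have pos z : 0 < z <= 1 -> iter n sgn_step z @[n --> \oo] --> (1 : R).
  move=> z01; have /andP[z0 z1] := z01.
  rewrite -[X in _ --> X]subr0.
  have -> : (fun n => iter n sgn_step z) = (fun n => 1 - (1 - iter n sgn_step z)).
    by apply/funext => n; rewrite subKr.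
  apply: cvgB; first exact: cvg_cst.
  apply: (@squeeze_cvgr _ _ _ _ (fun=> 0) (fun n => (1 - z / 2) ^+ n)).
  - apply: nearW => n.
    have [/andP[h1 h2] h3] := @iter_sgn_step_gt0 n z z01.
    by rewrite h3 andbT; lra.
  - exact: cvg_cst.
  - apply: cvg_expr; rewrite ger0_norm; lra.
have [y0|y0|->] := ltgtP y 0 => hy; last first.
- have E : (fun n => iter n sgn_step 0) = fun=> (0 : R).
    by apply/funext; elim=> //= n ->; rewrite /sgn_step mulr0 expr0n/= subr0 mul0r.
  by rewrite sgr0 E; exact: cvg_cst.
- by rewrite gtr0_sg//; apply: pos; rewrite y0/=; rewrite gtr0_norm in hy.
- rewrite ltr0_sg//.
  have -> : (fun n => iter n sgn_step y) = (fun n => - iter n sgn_step (- y)).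
    by apply/funext => n; rewrite -iter_sgn_stepN opprK.
  apply: cvgN; apply: pos; rewrite oppr_gt0 y0/=.
  by rewrite ltr0_norm in hy.
Qed.

Lemma trig_limit_iter_sgn n F :
  trig_limit F -> trig_limit (fun x => iter n sgn_step (F x)).
Proof.
move=> hF; elim: n => [|n IH]; first exact: hF.
have h3 := trig_limit_mul (trig_limit_mul IH IH) IH.
by apply: trig_limit_eq (trig_limit_lin (3 / 2) (- 2^-1) IH h3) => x /=; rewrite /sgn_step; field.
Qed.

Lemma trig_limit_sg_sin i (a c : R) :
  trig_limit (fun x : I -> R => Num.sg (sin ((x i - a) * c))).
Proof.
have h : trig_limit (fun x : I -> R => sin ((x i - a) * c)).
  (* Only cosines are primitive; a phase shift by a quarter period produces the sine. *)
  apply: trig_limit_eq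
    (trig_limit_cos (fun j => (j == i)%:R * c) (- a * c - pi / 2)) => x /=.
  rewrite addrA cosBpihalf; congr sin.
  rewrite (bigD1 i)//= eqxx mul1r big1 ?addr0; first by ring.
  by move=> j /negbTE ->; rewrite !mul0r.
have b x : `|sin ((x i - a) * c)| <= 1 by rewrite ler_norml sin_geN1 sin_le1.
apply: (@trig_limit_lim _ _ (fun n x => iter n sgn_step (sin ((x i - a) * c))) _ 1).
- by move=> n; exact: trig_limit_iter_sgn h.
- by move=> n x; exact: iter_sgn_step_le1.
- by move=> x; exact: cvg_iter_sgn_step.
Qed.

(** Stretch the period of the square wave: for fixed x, once n + 1 exceeds |x_i - a| the argument of
    the sine lies in (-1, 1), where the sine has the sign of its argument. *)
Lemma trig_limit_sg i (a : R) : trig_limit (fun x : I -> R => Num.sg (x i - a)).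
Proof.
apply: (@trig_limit_lim _ _ (fun n x => Num.sg (sin ((x i - a) * n.+1%:R^-1))) _ 1).
- by move=> n; exact: trig_limit_sg_sin.
- by move=> n x; rewrite normr_sg; case: (_ != 0).
move=> x; set y := x i - a.
apply: (@cvg_trans _ ((fun=> Num.sg y) @ \oo)); last exact: cvg_cst.
apply: near_eq_cvg.
near=> n.
have ny : `|y| < n.+1%:R.
  near: n; exists (Num.truncn `|y|) => // n /= hn.
  by rewrite (lt_le_trans (truncnS_gt _))// ler_nat ltnS.
have n0 : 0 < n.+1%:R :> R by rewrite ltr0n.
have pos (z : R) : 0 < z -> z < n.+1%:R -> Num.sg (sin (z * n.+1%:R^-1)) = 1.
  move=> z0 zn; apply: gtr0_sg; apply: sin_gt0_pi.
  rewrite divr_gt0//= ltr_pdivrMr//.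
  rewrite (lt_trans zn)// -[ltLHS]mul1r ltr_pM2r//.
  by rewrite (lt_le_trans _ (pi_ge2 _))// ltr1n.
have [y0|y0|->] := ltgtP y 0; last by rewrite mul0r sin0.
- rewrite ltr0_sg// -[X in sin (X * _)]opprK mulNr sinN sgrN pos ?oppr_gt0//.
  by rewrite ltr0_norm in ny.
- by rewrite gtr0_sg// pos//; rewrite gtr0_norm in ny.
Unshelve. all: by end_near.
Qed.

Definition trig_set B := trig_limit (\1_B : (I -> R) -> R).

(** If s is the sign of x_i - a, then (s^2 + s)/2 is 1 at s = 1 and vanishes at both s = 0 and s =
    -1, so the boundary hyperplane falls on the right side. *)
Lemma trig_set_gt i (a : R) : trig_set [set x | a < x i].
Proof.
have h := trig_limit_sg i a.
apply: trig_limit_eq (trig_limit_lin 2^-1 2^-1 (trig_limit_mul h h) h) => x /=.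
rewrite indicE.
have -> : (x \in [set z : I -> R | a < z i]) = (0 < x i - a).
  by rewrite subr_gt0; apply/idP/idP; rewrite inE.
have [y0|y0|->] := ltgtP (x i - a) 0.
- by rewrite ltr0_sg//=; ring.
- by rewrite gtr0_sg//=; field.
- by rewrite sgr0/=; ring.
Qed.

Lemma trig_setC B : trig_set B -> trig_set (~` B).
Proof.
move=> hB; apply: trig_limit_eq (trig_limit_lin 1 (-1) (trig_limit_cst 1) hB) => x /=.
by rewrite !indicE in_setC; case: (_ \in _) => /=; ring.
Qed.

Lemma trig_setU B B' : trig_set B -> trig_set B' -> trig_set (B `|` B').
Proof.
move=> hB hB'.
apply: trig_limit_eq (trig_limit_lin 1 1 hB (trig_limit_mul (trig_setC hB) hB')) => x /=.
by rewrite !indicE in_setC in_setU; do 2!case: (_ \in _) => /=; ring.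
Qed.

(** Stability under products gives finite unions directly, so no pi-lambda argument is required. A
    countable union is the limit of its partial unions, whose indicators are eventually constant at
    each point. *)
Lemma sigma_algebra_trig_set : sigma_algebra setT trig_set.
Proof.
have t0 : trig_set set0.
  by apply: trig_limit_eq (trig_limit_cst 0) => x; rewrite indic0.
split=> // [B hB|B hB]; first by rewrite setTD; exact: trig_setC.
apply: (@trig_limit_lim _ _ (fun n => \1_(\big[setU/set0]_(k < n) B k)) _ 1).
- by move=> n; elim/big_ind: _ => [|B1 B2|k _]; [exact: t0|exact: trig_setU|exact: hB].
- by move=> n x; rewrite indicE; case: (_ \in _); rewrite ?normr1 ?normr0.
move=> x; rewrite indicE; case: (boolP (x \in _)) => hx.
- apply: (@cvg_trans _ ((fun=> 1 : R) @ \oo)); last exact: cvg_cst.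
  apply: near_eq_cvg; move: hx; rewrite inE => -[k _ Bkx].
  exists k.+1 => // n /= kn; rewrite indicE mem_set//.
  by rewrite -bigcup_mkord; exists k.
- apply: (@cvg_trans _ ((fun=> 0 : R) @ \oo)); last exact: cvg_cst.
  apply: near_eq_cvg; apply: nearW => n; rewrite indicE memNset// => hn.
  move/negP: hx; apply; rewrite inE.
  by move: hn; rewrite -bigcup_mkord => -[k _ ?]; exists k.
Qed.

End TrigLimit.

(** * The Cramer-Wold theorem *)

Section SameLaw.
Variables (R : realType) (d : measure_display) (S : measurableType d).

Lemma same_law_integral (d1 d2 : measure_display)
    (T1 : measurableType d1) (T2 : measurableType d2)
    (m1 : {measure set T1 -> \bar R}) (m2 : {measure set T2 -> \bar R})
    (L1 : T1 -> S) (L2 : T2 -> S) (f : S -> \bar R) :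
  measurable_fun setT L1 -> measurable_fun setT L2 ->
  (forall B, measurable B -> m1 (L1 @^-1` B) = m2 (L2 @^-1` B)) ->
  measurable_fun [set: S] f -> (forall x, 0 <= f x)%E ->
  (\int[m1]_w f (L1 w) = \int[m2]_w f (L2 w))%E.
Proof.
move=> mL1 mL2 eqm mf f0.
transitivity (\int[pushforward m1 L1]_y f y)%E.
  by rewrite ge0_integral_pushforward.
transitivity (\int[pushforward m2 L2]_y f y)%E.
  by apply: eq_measure_integral => B mB _; exact: eqm.
by rewrite ge0_integral_pushforward.
Qed.

(** Moving the event from the domain of integration into the measure lets [same_law_integral] be
    used on an event. *)
Lemma integral_mrestr (m : {measure set S -> \bar R}) (A : set S)
    (mA : measurable A) (f : S -> \bar R) :
  measurable_fun [set: S] f -> (forall x, 0 <= f x)%E ->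
  (\int[mrestr m mA]_x f x = \int[m]_(x in A) f x)%E.
Proof.
move=> mf f0.
have mf' B : measurable_fun B f by exact: measurable_funTS.
rewrite -(setUv A) ge0_integral_setU//; last 2 first.
- exact: measurableC.
- by apply/disj_setPRL.
have mAC : mrestr m mA (~` A) = 0%E by rewrite /mrestr setICl measure0.
rewrite [X in (_ + X)%E]null_set_integral ?adde0//; last exact: measurableC.
by apply: eq_measure_integral => B mB BA; rewrite /= /mrestr setIidl.
Qed.

End SameLaw.

Section CramerWold.
Variables (R : realType) (I : finType).

(** Generators of the product sigma-algebra on [I -> R], chosen to be the sets covered by
    [trig_set_gt]. *)
Definition coord_gt : set (set (I -> R)) :=
  [set B | exists i a, B = [set x | a < x i]].

Lemma measurable_coord i :
  measurable_fun [set: g_sigma_algebraType coord_gt] (fun x : I -> R => x i).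
Proof.
apply: (measurability _ (RGenOInfty.measurableE R)).
move=> _ [_ [a ->] <-]; apply: sub_sigma_algebra; exists i, a.
by rewrite setTI; apply/seteqP; split => x /=; rewrite in_itv/= andbT.
Qed.

Variables (d : measure_display) (T : measurableType d) (P : probability T R).
Variable A : set T.
Hypothesis mA : measurable A.

Lemma integral_bounded_cvg (f : nat -> T -> R) (g : T -> R) (M : R) :
  (forall n, measurable_fun setT (f n)) -> (forall n x, `|f n x| <= M) ->
  (forall x, f n x @[n --> \oo] --> g x) ->
  measurable_fun setT g /\
  (\int[P]_(x in A) (f n x)%:E)%E @[n --> \oo] --> (\int[P]_(x in A) (g x)%:E)%E.
Proof.
move=> mf fM fg.
have mg : measurable_fun setT g.
  by apply: measurable_fun_cvg mf _ => x _; exact: fg.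
split=> //.
have [] := @dominated_convergence _ _ _ P A mA (fun n x => (f n x)%:E)
   (EFin \o g) (cst M%:E).
- by move=> n; apply/measurable_EFinP/measurable_funTS.
- by apply/measurable_EFinP/measurable_funTS.
- by apply/aeW => x _; apply: cvg_EFin; [exact: nearW|exact: fg].
- by apply: finite_measure_integrable_cst.
- by apply/aeW => x n _ /=; rewrite lee_fin.
- by [].
Qed.

Lemma measurable_cos_comp (g : T -> R) :
  measurable_fun setT g -> measurable_fun setT (fun w => cos (g w)).
Proof.
apply: (@measurableT_comp _ _ _ _ _ _ cos).
apply: continuous_measurable_fun; exact: continuous_cos.
Qed.

Lemma trig_limit_measurable (X : T -> I -> R) F :
  (forall i, measurable_fun setT (X ^~ i)) -> trig_limit F ->
  measurable_fun setT (F \o X).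
Proof.
move=> mX; elim=> [t b|a b F1 F2 _ h1 _ h2|F' G M _ h HM HG].
- apply: measurable_cos_comp; apply: measurable_funD => //.
  by apply: measurable_sum => i; apply: measurable_funM.
- by apply: measurable_funD; apply: measurable_funM.
- have [] := @integral_bounded_cvg (fun n => F' n \o X) (G \o X) M => //.
  + by move=> n x; exact: HM.
  + by move=> x; exact: HG.
Qed.

(** Both sides are linear in [F] and continuous under bounded limits, so only cosines remain, and
    these depend on a single linear functional. *)
Lemma trig_limit_law (X X' : T -> I -> R) :
  (forall i, measurable_fun setT (X ^~ i)) ->
  (forall i, measurable_fun setT (X' ^~ i)) ->
  (forall (t : I -> R) B, measurable B ->
     P (A `&` (fun w => \sum_i t i * X w i) @^-1` B) =
     P (A `&` (fun w => \sum_i t i * X' w i) @^-1` B)) ->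
  forall F, trig_limit F ->
  (\int[P]_(w in A) (F (X w))%:E = \int[P]_(w in A) (F (X' w))%:E)%E.
Proof.
move=> mX mX' eqlaw F.
have int_bounded (Y : T -> I -> R) G : (forall i, measurable_fun setT (Y ^~ i)) ->
    trig_limit G -> P.-integrable A (EFin \o (G \o Y)).
  move=> mY hG; apply: measurable_bounded_integrable => //.
  - by rewrite (le_lt_trans (probability_le1 P mA))// ltry.
  - by apply: measurable_funTS; exact: trig_limit_measurable.
  - have [M HM] := trig_limit_bounded hG.
    exists M; split=> [|x Mx y _ /=]; first exact: num_real.
    by rewrite (le_trans (HM _)) ?ltW.
elim=> [t b|a b F1 F2 t1 h1 t2 h2|F' G M hF' h HM HG]; last first.
- have cX (Y : T -> I -> R) : (forall i, measurable_fun setT (Y ^~ i)) ->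
    (\int[P]_(w in A) (F' n (Y w))%:E)%E @[n --> \oo] -->
    (\int[P]_(w in A) (G (Y w))%:E)%E.
    move=> mY.
    have [] := @integral_bounded_cvg (fun n => F' n \o Y) (G \o Y) M => //.
    + by move=> n; exact: trig_limit_measurable.
    + by move=> n x; exact: HM.
    + by move=> x; exact: HG.
  rewrite -(cvg_lim _ (cX X mX))// -(cvg_lim _ (cX X' mX'))//.
  by congr (lim (_ @ \oo)); apply/funext => n; exact: h.
- have lin (Y : T -> I -> R) : (forall i, measurable_fun setT (Y ^~ i)) ->
    (\int[P]_(w in A) (a * F1 (Y w) + b * F2 (Y w))%:E =
     a%:E * \int[P]_(w in A) (F1 (Y w))%:E + b%:E * \int[P]_(w in A) (F2 (Y w))%:E)%E.
    move=> mY; rewrite -!integralZl//; [|exact: int_bounded|exact: int_bounded].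
    rewrite -integralD//.
    + by apply: integrableZl => //; exact: int_bounded.
    + by apply: integrableZl => //; exact: int_bounded.
  by rewrite !lin// h1 h2.
pose L (Y : T -> I -> R) w := \sum_i t i * Y w i.
have mL (Y : T -> I -> R) : (forall i, measurable_fun setT (Y ^~ i)) ->
    measurable_fun setT (L Y).
  by move=> mY; apply: measurable_sum => i; apply: measurable_funM.
have mcos (Y : T -> I -> R) : (forall i, measurable_fun setT (Y ^~ i)) ->
    measurable_fun setT (fun w => cos (L Y w + b)).
  by move=> mY; apply: measurable_cos_comp; apply: measurable_funD => //; exact: mL.
(* Adding 1 makes the integrand nonnegative, as the change of variables demands; the extra mass
   [P A] is finite and can be subtracted again. *)
have cosE (Y : T -> I -> R) : (forall i, measurable_fun setT (Y ^~ i)) ->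
   (\int[P]_(w in A) (cos (L Y w + b))%:E =
    \int[mrestr P mA]_w (1 + cos (L Y w + b))%:E - P A)%E.
  move=> mY.
  have mc : measurable_fun setT (fun w => (1 + cos (L Y w + b))%:E).
    by apply/measurable_EFinP; apply: measurable_funD => //; exact: mcos.
  have c0 w : (0 <= (1 + cos (L Y w + b))%:E)%E.
    by rewrite lee_fin -lerBlDl sub0r cos_geN1.
  rewrite (integral_mrestr _ mA mc c0).
  have i1 : P.-integrable A (EFin \o cst (1 : R)) by exact: finite_measure_integrable_cst.
  have i2 : P.-integrable A (fun w => (cos (L Y w + b))%:E).
    exact: (int_bounded Y _ mY (trig_limit_cos t b)).
  have i1E : (\int[P]_(x in A) (EFin \o cst (1%R : R)) x = P A)%E.
    rewrite (eq_integral (cst (1%:E : \bar R)))//.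
    by rewrite (integral_cst P mA (1%:E : \bar R)) mul1e.
  rewrite (integralD mA i1 i2) i1E addeAC subee ?add0e//.
  by apply: fin_num_measure.
rewrite (cosE X mX) (cosE X' mX'); congr (_ - _)%E.
apply: (@same_law_integral R _ R _ _ _ _ (mrestr P mA) (mrestr P mA) _ _
  (fun y => (1 + cos (y + b))%:E) (mL _ mX) (mL _ mX')).
- by move=> B mB; rewrite /= /mrestr ![_ `&` A]setIC; exact: eqlaw.
- apply/measurable_EFinP; apply: measurable_funD => //.
  apply: (@measurableT_comp _ _ _ _ _ _ cos).
    apply: continuous_measurable_fun; exact: continuous_cos.
  exact: measurable_funD.
- by move=> y; rewrite lee_fin -lerBlDl sub0r cos_geN1.
Qed.

(** Sets with a trigonometric-limit indicator form a sigma-algebra containing the generators, hence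
    all measurable sets, so [trig_limit_law] applied to indicators identifies the two laws. The
    event [A] is carried along because laws are compared jointly with the routes. *)
Lemma cramer_wold (X X' : T -> I -> R)
    (f : g_sigma_algebraType coord_gt -> \bar R) :
  (forall i, measurable_fun setT (X ^~ i)) ->
  (forall i, measurable_fun setT (X' ^~ i)) ->
  (forall (t : I -> R) B, measurable B ->
     P (A `&` (fun w => \sum_i t i * X w i) @^-1` B) =
     P (A `&` (fun w => \sum_i t i * X' w i) @^-1` B)) ->
  measurable_fun setT f -> (forall x, 0 <= f x)%E ->
  (\int[P]_(w in A) f (X w) = \int[P]_(w in A) f (X' w))%E.
Proof.
move=> mX mX' eqlaw mf f0.
have mV (Y : T -> I -> R) : (forall i, measurable_fun setT (Y ^~ i)) ->
    measurable_fun setT (Y : T -> g_sigma_algebraType coord_gt).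
  move=> mY; apply: (@measurability _ _ T (g_sigma_algebraType coord_gt) setT Y coord_gt erefl).
  move=> _ [_ [i [a ->]] <-].
  rewrite setTI (_ : _ @^-1` _ = (Y ^~ i) @^-1` `]a, +oo[%classic).
    by rewrite -[X in measurable X]setTI; exact: mY.
  by apply/seteqP; split => x /=; rewrite in_itv/= andbT.
have mfY (Y : T -> I -> R) : (forall i, measurable_fun setT (Y ^~ i)) ->
    measurable_fun setT (fun w => f (Y w)).
  by move=> mY; apply: (measurableT_comp mf); exact: mV.
rewrite -!(integral_mrestr _ mA)//; [|exact: mfY|exact: mfY].
apply: same_law_integral (mV _ mX) (mV _ mX') _ mf f0 => B mB.
have /(trig_limit_law mX mX' eqlaw) : trig_set B.
  by apply: (smallest_sub (@sigma_algebra_trig_set R I) _ mB) => _ [i [a ->]]; exact: trig_set_gt.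
have E (Y : T -> I -> R) : (fun w => (\1_B (Y w))%:E) = (fun w => (\1_(Y @^-1` B) w)%:E) :> (T -> \bar R).
  by apply/funext => w; rewrite !indicE; congr (_%:R%:E); apply: congr1; apply/idP/idP; rewrite !inE.
have mpre (Y : T -> I -> R) : (forall i, measurable_fun setT (Y ^~ i)) ->
    measurable (Y @^-1` B).
  by move=> mY; rewrite -[X in measurable X]setTI; exact: mV.
by rewrite !E !integral_indic//; exact: mpre.
Qed.

End CramerWold.

(** * Gaussian laws *)

Section GaussLaw.
Variable R : realType.
Local Notation leb := (@lebesgue_measure R).
Local Notation N01 := (normal_prob (0 : R) 1).

Lemma measurable_affine (m s : R) :
  measurable_fun [set: R] (fun x => m + s * x).
Proof. by apply: measurable_funD => //; apply: measurable_funM. Qed.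

(** By uniqueness of Lebesgue measure: the rescaled image measure gives each half-open interval its
    length. *)
Lemma lebesgue_measure_affine (m s : R) (B : set R) : 0 < s -> measurable B ->
  (leb B = s%:E * leb ((fun x => (m + s * x)%R) @^-1` B))%E.
Proof.
move=> s0 mB.
pose F : measurableTypeR R -> measurableTypeR R := fun x : R => m + s * x.
have mF : measurable_fun setT F := measurable_affine m s.
pose mu0 : {measure set (measurableTypeR R) -> \bar R} :=
  mscale (NngNum (ltW s0)) (pushforward leb F).
pose mu' := mu0 mF.
have /(_ _ B mB) -> // := @lebesgue_measure_unique R mu'.
move=> _ [[a b] _ <-] /=.
rewrite /mu' /mu0 /mscale /= /pushforward.
have -> : F @^-1` `]a, b]%classic = `](a - m) / s, (b - m) / s]%classic.
  have E x : (a < m + s * x <= b) = ((a - m) / s < x <= (b - m) / s).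
    by rewrite ltr_pdivrMr// ler_pdivlMr// ltrBlDl lerBrDl mulrC.
  by apply/seteqP; split=> x /=; rewrite !in_itv/= E.
rewrite !lebesgue_measure_itv/= !lte_fin ltr_pM2r ?invr_gt0// ltrD2r.
case: ifPn => _; last by rewrite mule0.
rewrite -!EFinD -EFinM; congr EFin; field.
exact: lt0r_neq0.
Qed.

Lemma normal_pdf_affine (m s x : R) : 0 < s ->
  s * normal_pdf m s (m + s * x) = normal_pdf 0 1 x.
Proof.
move=> s0; have sn0 := lt0r_neq0 s0.
rewrite !normal_pdfE ?oner_neq0// mulrA; congr (_ * _).
  rewrite /normal_peak -mulrnAr sqrtrM ?sqr_ge0// sqrtr_sqr gtr0_norm//.
  by rewrite expr1n mul1r invfM mulrA divff ?mul1r.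
rewrite /normal_fun; congr expR; field.
exact: sn0.
Qed.

Lemma normal_prob_affine (m s : R) (B : set R) : 0 < s -> measurable B ->
  normal_prob m s B = N01 ((fun x => m + s * x) @^-1` B).
Proof.
move=> s0 mB.
pose F : measurableTypeR R -> measurableTypeR R := fun x : R => m + s * x.
have mF : measurable_fun setT F := measurable_affine m s.
pose mu0 : {measure set (measurableTypeR R) -> \bar R} :=
  mscale (NngNum (ltW s0)) (pushforward leb F).
pose mu' := mu0 mF.
have mFB : measurable (F @^-1` B).
  by rewrite -[X in measurable X]setTI; exact: measurable_affine.
have mpdf : measurable_fun B (fun x => (normal_pdf m s x)%:E).
  by apply: measurable_funTS; apply/measurable_EFinP; exact: measurable_normal_pdf.
transitivity (\int[mu']_(x in B) (normal_pdf m s x)%:E)%E.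
  by apply: eq_measure_integral => C mC _; exact: lebesgue_measure_affine.
rewrite ge0_integral_mscale//=; last by move=> x _; rewrite lee_fin normal_pdf_ge0.
rewrite ge0_integral_pushforward//=; last by move=> x _; rewrite lee_fin normal_pdf_ge0.
rewrite -ge0_integralZl//=.
- by apply: eq_integral => x _; rewrite -EFinM normal_pdf_affine.
- apply: measurable_funTS; apply/measurable_EFinP.
  by apply: (measurableT_comp (measurable_normal_pdf m s)); exact: measurable_affine.
- by move=> x _; rewrite lee_fin normal_pdf_ge0.
- by rewrite lee_fin ltW.
Qed.

(** Treats the degenerate and nondegenerate cases together: when v = 0 the affine map is constant
    and its image of the standard normal is the Dirac mass. *)
Lemma gauss_lawE (m v : R) (B : set R) : 0 <= v -> measurable B ->
  gauss_law m v B = N01 ((fun x => m + Num.sqrt v * x) @^-1` B).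
Proof.
rewrite le_eqVlt /gauss_law => /predU1P[<- mB|v0 mB]; last first.
  by rewrite gt_eqF// normal_prob_affine// sqrtr_gt0.
rewrite eqxx sqrtr0 diracE; have [mB'|mB'] := pselect (B m).
  rewrite mem_set// (_ : _ @^-1` _ = setT) ?probability_setT//.
  by apply/seteqP; split => // x _ /=; rewrite mul0r addr0.
rewrite memNset// (_ : _ @^-1` _ = set0) ?measure0//.
by apply/seteqP; split => // x /=; rewrite mul0r addr0.
Qed.

(* Equal to 1, but only its positivity matters: both risk bounds carry this
   factor, so it need not even be known to be finite. *)
Definition normal_var : \bar R := (\int[N01]_x (x ^+ 2)%:E)%E.

(** A zero integral would force x = 0 almost surely, but the normal law is dominated by Lebesgue
    measure and does not charge a point. *)
Lemma normal_var_gt0 : (0 < normal_var)%E.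
Proof.
rewrite lt_neqAle integral_ge0 ?andbT; last by move=> x _; rewrite lee_fin sqr_ge0.
apply/eqP => h.
have mf : measurable_fun [set: R] (fun x => (x ^+ 2)%:E).
  by apply/measurable_EFinP; exact: measurable_funX.
have /ae_eq_integral_abs : (\int[N01]_(x in setT) `|(x ^+ 2)%:E| = 0)%E.
  by rewrite [RHS]h; apply: eq_integral => x _; rewrite gee0_abs// lee_fin sqr_ge0.
move=> /(_ measurableT mf) [M [mM M0 hM]].
have mset0 : measurable [set (0 : R)] by exact: measurable_set1.
have N0 : N01 [set 0] = 0%E.
  have /null_content_dominatesP := normal_prob_dominates (0 : R) 1.
  by apply => //; exact: lebesgue_measure_set1.
have : (N01 setT <= N01 (M `|` [set 0%R]))%E.
  apply: le_measure; rewrite ?inE//; first exact: measurableU.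
  move=> x _; have [->|x0] := eqVneq x 0; first by right.
  left; apply: hM => /= /(_ Logic.I) [] /eqP.
  by rewrite expf_eq0/= (negbTE x0).
rewrite probability_setT measureU0// M0.
by rewrite leNgt lte_fin ltr01.
Qed.

Section Moments.
Variables (d : measure_display) (T : measurableType d) (P : probability T R).
Variables (A : set T) (mA : measurable A) (k m v : R) (k0 : 0 <= k) (v0 : 0 <= v).
Variables (L : T -> R) (mL : measurable_fun setT L).
Hypothesis law : forall B : set R, measurable B ->
  P (A `&` L @^-1` B) = (k%:E * gauss_law m v B)%E.

Lemma gauss_law_integral (f : R -> \bar R) :
  measurable_fun setT f -> (forall x, 0 <= f x)%E ->
  (\int[P]_(w in A) f (L w) =
   k%:E * \int[N01]_x f (m + Num.sqrt v * x)%R)%E.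
Proof.
move=> mf f0.
rewrite -(integral_mrestr _ mA (measurableT_comp mf mL))//=.
rewrite (@same_law_integral R _ R _ _ _ _ _ (mscale (NngNum k0) N01)
  L (fun x : R => m + Num.sqrt v * x) f)//.
- rewrite ge0_integral_mscale//.
  by apply: (measurableT_comp mf); exact: measurable_affine.
- exact: measurable_affine.
- move=> B mB; rewrite /= /mrestr /mscale/= setIC law// gauss_lawE//.
Qed.

Lemma gauss_law_var :
  (\int[P]_(w in A) ((L w - m) ^+ 2)%:E = (k * v)%:E * normal_var)%E.
Proof.
rewrite (gauss_law_integral (f := fun x => ((x - m) ^+ 2)%:E)).
- rewrite EFinM -muleA; congr (_ * _)%E.
  rewrite -ge0_integralZl//=.
  + apply: eq_integral => x _; rewrite -EFinM addrAC subrr add0r exprMn sqr_sqrtr//.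
  + by apply/measurable_EFinP; exact: measurable_funX.
  + by move=> x _; rewrite lee_fin sqr_ge0.
- apply/measurable_EFinP; apply: measurable_funX; exact: measurable_funB.
- by move=> x; rewrite lee_fin sqr_ge0.
Qed.

End Moments.
End GaussLaw.

(** * Risk given the routes *)

Section QuadForm.
Variables (R : realType) (I : finType).

(** Schur test: |x_s M_st x_t| <= |M_st| (x_s^2 + x_t^2)/2, and by symmetry both halves are
    controlled by row sums. *)
Lemma quad_form_le (M : I -> I -> R) (C : R) (x : I -> R) :
  (forall s t, M s t = M t s) -> (forall s, \sum_t `|M s t| <= C) ->
  \sum_s \sum_t x s * M s t * x t <= C * \sum_s x s ^+ 2.
Proof.
move=> symM rowM.
have le2 s t : x s * M s t * x t <= 2^-1 * (`|M s t| * x s ^+ 2) + 2^-1 * (`|M t s| * x t ^+ 2).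
  rewrite (symM t s) (le_trans (ler_norm _))// !normrM.
  rewrite -(real_normK (num_real (x s))) -(real_normK (num_real (x t))).
  have := normr_ge0 (M s t); have := normr_ge0 (x s); have := normr_ge0 (x t).
  have := sqr_ge0 (`|x s| - `|x t|); nra.
rewrite (@le_trans _ _ (\sum_s \sum_t (2^-1 * (`|M s t| * x s ^+ 2) + 2^-1 * (`|M t s| * x t ^+ 2))))//.
  by apply: ler_sum => s _; apply: ler_sum => t _; exact: le2.
under eq_bigr do rewrite big_split/=.
rewrite big_split/= [X in _ + X]exchange_big/=.
have h : \sum_s \sum_t 2^-1 * (`|M s t| * x s ^+ 2) <= 2^-1 * (C * \sum_s x s ^+ 2).
  under eq_bigr do rewrite -mulr_sumr -mulr_suml.
  rewrite -mulr_sumr ler_pM2l ?invr_gt0// mulr_sumr.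
  by apply: ler_sum => s _; apply: ler_wpM2r => //; exact: sqr_ge0.
by apply: (le_trans (lerD h h)); lra.
Qed.

(** Compute W^T M W in two ways. The symmetry is wanted for [Psi], so that the Schur test applies to
    it. *)
Lemma inverse_sym (M W : I -> I -> R) :
  (forall s t, M s t = M t s) ->
  (forall s u, \sum_t M s t * W t u = (s == u)%:R) ->
  forall s t, W s t = W t s.
Proof.
move=> symM MW s u.
have WM s' u' : \sum_t W t s' * M t u' = (s' == u')%:R.
  by rewrite eq_sym -MW; apply: eq_bigr => t _; rewrite symM mulrC.
have : \sum_t \sum_r W t s * M t r * W r u = W s u.
  rewrite exchange_big/= (bigD1 s)//= -mulr_suml WM eqxx mul1r.
  rewrite big1 ?addr0// => r /negbTE rs.
  by rewrite -mulr_suml WM eq_sym rs mul0r.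
move=> <-; rewrite (bigD1 u)//= (eq_bigr (fun r => W u s * (M u r * W r u))); last first.
  by move=> r _; rewrite mulrA.
rewrite -mulr_sumr MW eqxx mulr1 big1 ?addr0// => t /negbTE tu.
by under eq_bigr do rewrite -mulrA; rewrite -mulr_sumr MW tu mulr0.
Qed.

End QuadForm.

Section ConditionalRisk.
Variables (R : realType) (p N : nat) (tau2 mu : R) (Sigma Psi : seg p -> seg p -> R).
Hypothesis tau2_gt0 : 0 < tau2.
Hypothesis Sigma_sym : forall s t, Sigma s t = Sigma t s.
Hypothesis Sigma_psd : forall v : seg p -> R,
  0 <= \sum_s \sum_t v s * Sigma s t * v t.
Hypothesis SigmaPsi : forall s u, \sum_t Sigma s t * Psi t u = (s == u)%:R.

Variables (d : measure_display) (T : measurableType d) (P : probability T R).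
Variables (theta : T -> seg p -> R) (eps : 'I_N -> T -> seg p -> R).
Hypothesis mtheta : forall s, measurable_fun [set: T] (fun w => theta w s).
Hypothesis meps : forall n s, measurable_fun [set: T] (fun w => eps n w s).

Definition lin_comb (u : seg p -> R) (v : 'I_N -> seg p -> R) (w : T) : R :=
  \sum_s u s * theta w s + \sum_(n < N) \sum_s v n s * eps n w s.

Definition lin_cov (u u' : seg p -> R) (v v' : 'I_N -> seg p -> R) : R :=
  tau2 * \sum_s u s * u' s +
  \sum_(n < N) \sum_s \sum_t v n s * Sigma s t * v' n t.

Definition lin_var u v : R := lin_cov u u v v.

Lemma measurable_lin_comb u v : measurable_fun setT (lin_comb u v).
Proof.
apply: measurable_funD.
  by apply: measurable_sum => s; apply: measurable_funM.
by apply: measurable_sum => n; apply: measurable_sum => s; apply: measurable_funM.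
Qed.

Lemma lin_var_ge u v : tau2 * \sum_s u s ^+ 2 <= lin_var u v.
Proof.
rewrite /lin_var /lin_cov -[leLHS]addr0; apply: lerD.
  by rewrite le_eqVlt; apply/orP; left; apply/eqP; congr (_ * _); apply: eq_bigr.
by apply: sumr_ge0 => n _.
Qed.

Lemma lin_var_ge0 u v : 0 <= lin_var u v.
Proof.
apply: le_trans (lin_var_ge u v).
by rewrite mulr_ge0 ?(ltW tau2_gt0)// sumr_ge0// => s _; rewrite sqr_ge0.
Qed.

Lemma lin_comb_shift u u' v v' (x : R) w :
  lin_comb (fun s => u s + x * u' s) (fun n s => v n s + x * v' n s) w =
  lin_comb u v w + x * lin_comb u' v' w.
Proof.
rewrite /lin_comb mulrDr !mulr_sumr.
under eq_bigr do rewrite mulrDl -mulrA.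
rewrite big_split/=.
under [X in _ + X = _]eq_bigr => n _.
  under eq_bigr do rewrite mulrDl -mulrA.
  rewrite big_split/= -mulr_sumr.
  over.
rewrite big_split/=; ring.
Qed.

Lemma lin_var_shift u u' v v' (x : R) :
  lin_var (fun s => u s + x * u' s) (fun n s => v n s + x * v' n s) =
  lin_var u v + 2 * x * lin_cov u u' v v' + x ^+ 2 * lin_var u' v'.
Proof.
rewrite /lin_var /lin_cov.
have -> : \sum_s (u s + x * u' s) * (u s + x * u' s) =
    \sum_s u s * u s + 2 * x * \sum_s u s * u' s + x ^+ 2 * \sum_s u' s * u' s.
  by rewrite !mulr_sumr -!big_split/=; apply: eq_bigr => s _; ring.
have -> : \sum_(n < N) \sum_s \sum_t (v n s + x * v' n s) * Sigma s t * (v n t + x * v' n t) =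
    \sum_(n < N) \sum_s \sum_t v n s * Sigma s t * v n t +
    2 * x * \sum_(n < N) \sum_s \sum_t v n s * Sigma s t * v' n t +
    x ^+ 2 * \sum_(n < N) \sum_s \sum_t v' n s * Sigma s t * v' n t.
  rewrite !mulr_sumr -!big_split/=; apply: eq_bigr => n _.
  have -> : 2 * x * (\sum_s \sum_t v n s * Sigma s t * v' n t) =
     x * (\sum_s \sum_t v n s * Sigma s t * v' n t) +
     x * (\sum_s \sum_t v' n s * Sigma s t * v n t).
    have -> : \sum_s \sum_t v' n s * Sigma s t * v n t =
              \sum_s \sum_t v n s * Sigma s t * v' n t.
      rewrite exchange_big/=; apply: eq_bigr => s _; apply: eq_bigr => t _.
      by rewrite (Sigma_sym t s); ring.
    ring.
  rewrite !mulr_sumr -!big_split/=; apply: eq_bigr => s _.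
  rewrite !mulr_sumr -!big_split/=; apply: eq_bigr => t _; ring.
ring.
Qed.

(* The posterior precision of [theta_s] is at most [(1 + c * N_s) / tau2]. *)
Definition uncertainty (c : R) (ys : route_cfg p N) (y : {set seg p}) : R :=
  \sum_(s in y) (1 + c * #|[set n | s \in ys n]|%:R)^-1.

Variables (ys : route_cfg p N) (y : {set seg p}).
Local Notation hits s := (#|[set n | s \in ys n]|).

(** Here [A] stands for the event that fixes all routes and [k] for its probability. Keeping the
    joint law instead of the conditional one avoids dividing by a [k] that may be 0. *)
Variables (A : set T) (mA : measurable A) (k : R) (k_ge0 : 0 <= k).
Hypothesis law : forall u v (B : set R), measurable B ->
  P (A `&` lin_comb u v @^-1` B) =
  (k%:E * gauss_law (mu * \sum_s u s) (lin_var u v) B)%E.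

(** The data with the historical routes frozen at [ys]; it agrees with [data] on the event that
    these routes occur. *)
Definition trip_data (w : T) : N.-tuple (#|seg p|.-tuple R) :=
  [tuple [tuple (let s := enum_val j in
                 if s \in ys n then theta w s + eps n w s else 0)
          | j < #|seg p|] | n < N].

Lemma measurable_trip_data : measurable_fun setT trip_data.
Proof.
apply/measurable_fun_tnthP => n; apply/measurable_fun_tnthP => j.
pose s := enum_val j.
rewrite (_ : _ \o _ = fun w => if s \in ys n then theta w s + eps n w s else 0).
  by case: (s \in ys n) => //; exact: measurable_funD.
by apply/funext => w /=; rewrite !tnth_mktuple.
Qed.

Lemma measurable_sum_in (D : {set seg p}) :
  measurable_fun setT (fun w => \sum_(s in D) theta w s).
Proof.
by under eq_fun do rewrite big_mkcond/=; apply: measurable_sum => s; case: (s \in D).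
Qed.

Lemma hitsE s : \sum_(n < N) (s \in ys n)%:R = (hits s)%:R :> R.
Proof.
rewrite -natr_sum -sum1_card [in RHS]big_mkcond/=; congr (_%:R); apply: eq_bigr => n _.
by rewrite (_ : (n \in _) = (s \in ys n)); [case: (s \in ys n)|apply/idP/idP; rewrite inE].
Qed.

(** * Lower bound for every estimator, given the routes *)

Section LowerBound.
Variable C : R.
Hypothesis C_ge0 : 0 <= C.
Hypothesis Psi_row : forall s, \sum_t `|Psi s t| <= C.

Let a (s : seg p) : R := (s \in y)%:R / (1 + tau2 * C * (hits s)%:R).
Let b (n : 'I_N) (s : seg p) : R :=
  - tau2 * \sum_t Psi s t * ((t \in ys n)%:R * a t).
Let S := uncertainty (tau2 * C) ys y.

Let den_gt0 s : 0 < 1 + tau2 * C * (hits s)%:R.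
Proof. by rewrite ltr_wpDr// !mulr_ge0// ltW. Qed.

Let aE : \sum_(s in y) a s = S.
Proof. by apply: eq_bigr => s sy; rewrite /a sy mul1r. Qed.

Let sumaE : \sum_s a s = S.
Proof.
rewrite -aE [RHS]big_mkcond/=; apply: eq_bigr => s _.
by rewrite /a; case: (s \in y); rewrite // mul0r.
Qed.

Let Sigma_b n s : \sum_t Sigma s t * b n t = - tau2 * ((s \in ys n)%:R * a s).
Proof.
pose z t := (t \in ys n)%:R * a t.
transitivity (\sum_t - tau2 * \sum_r Sigma s t * (Psi t r * z r)).
  by apply: eq_bigr => t _; rewrite /b mulrCA; congr (_ * _); rewrite mulr_sumr.
rewrite -mulr_sumr exchange_big/=; congr (_ * _).
have E r : \sum_t Sigma s t * (Psi t r * z r) = (s == r)%:R * z r.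
  by rewrite -SigmaPsi mulr_suml; apply: eq_bigr => t _; rewrite mulrA.
rewrite (eq_bigr _ (fun r _ => E r)) (bigD1 s)//= eqxx mul1r big1 ?addr0// => t.
by rewrite eq_sym => /negbTE ->; rewrite mul0r.
Qed.

(** The precision matrix in [b] cancels against [Sigma]. A functional of the data has u_s equal to
    the sum of v_{n,s} over the trips through s, so its covariance with [lin_comb a b] is 0; the
    target, u the indicator of [y], gives [tau2 * S]. *)
Let cov_b u v : lin_cov u a v b =
  tau2 * (\sum_s (u s - \sum_(n < N) v n s * (s \in ys n)%:R) * a s).
Proof.
rewrite /lin_cov.
have -> : \sum_(n < N) \sum_s \sum_t v n s * Sigma s t * b n t =
    - tau2 * \sum_s (\sum_(n < N) v n s * (s \in ys n)%:R) * a s.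
  rewrite mulr_sumr.
  under [RHS]eq_bigr do rewrite mulr_suml mulr_sumr.
  rewrite [RHS]exchange_big/=; apply: eq_bigr => n _; apply: eq_bigr => s _.
  under eq_bigr do rewrite -mulrA.
  by rewrite -mulr_sumr Sigma_b; ring.
rewrite mulNr -mulrBr -sumrB; congr (_ * _); apply: eq_bigr => s _; ring.
Qed.

(** By the Schur test each visit to s costs at most C a_s^2, for a total of tau2 times the sum of (1
    + tau2 C N_s) a_s^2. The weights are chosen so that (1 + tau2 C N_s) a_s is the indicator of
    [y], which leaves the sum of the a_s. *)
Let var_le : lin_var a b <= tau2 * S.
Proof.
rewrite /lin_var cov_b -sumaE ler_pM2l//.
have -> : \sum_s (a s - \sum_(n < N) b n s * (s \in ys n)%:R) * a s =
   \sum_s a s ^+ 2 + tau2 * \sum_(n < N) \sum_s \sum_t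
     ((s \in ys n)%:R * a s) * Psi s t * ((t \in ys n)%:R * a t).
  rewrite exchange_big/= mulr_sumr -big_split/=; apply: eq_bigr => s _.
  rewrite mulrBl -expr2; congr (_ + _).
  rewrite mulr_suml mulr_sumr -sumrN; apply: eq_bigr => n _.
  have -> : \sum_t (s \in ys n)%:R * a s * Psi s t * ((t \in ys n)%:R * a t) =
     (s \in ys n)%:R * a s * \sum_t Psi s t * ((t \in ys n)%:R * a t).
    by rewrite mulr_sumr; apply: eq_bigr => t _; rewrite -!mulrA.
  by rewrite /b; ring.
have h n : \sum_s \sum_t ((s \in ys n)%:R * a s) * Psi s t * ((t \in ys n)%:R * a t) <=
    C * \sum_s ((s \in ys n)%:R * a s ^+ 2).
  apply: (le_trans (quad_form_le _ (inverse_sym Sigma_sym SigmaPsi) Psi_row)).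
  rewrite ler_wpM2l//; apply: ler_sum => s _.
  by case: (s \in ys n); rewrite ?mul1r// !mul0r expr0n.
apply: (@le_trans _ _ (\sum_s a s ^+ 2 + tau2 * \sum_(n < N) C * \sum_s ((s \in ys n)%:R * a s ^+ 2))).
  by rewrite lerD2l ler_pM2l//; apply: ler_sum => n _; exact: h.
rewrite -mulr_sumr exchange_big/= !mulr_sumr -big_split/=.
apply: ler_sum => s _; rewrite -mulr_suml.
rewrite hitsE.
have -> : a s ^+ 2 + tau2 * (C * ((hits s)%:R * a s ^+ 2)) =
  a s * ((1 + tau2 * C * (hits s)%:R) * a s) by ring.
have -> : (1 + tau2 * C * (hits s)%:R) * a s = (s \in y)%:R.
  by rewrite /a mulrCA divff ?mulr1// gt_eqF.
by rewrite /a; case: (s \in y); rewrite ?mulr1// mul0r mulr0.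
Qed.


(** Target and observations as one random vector: [None] indexes the target, [Some (n, s)] an
    observed travel time. *)
Let X (w : T) (i : option ('I_N * seg p)) : R :=
  if i is Some (n, s) then (if s \in ys n then theta w s + eps n w s else 0)
  else \sum_(s in y) theta w s.

(** Regression coefficient of the target on [lin_comb a b]; subtracting twice the regression term,
    instead of once, reflects rather than projects. *)
Let kappa : R := tau2 * S / lin_var a b.

Let X' (w : T) (i : option ('I_N * seg p)) : R :=
  if i is Some _ then X w i
  else X w i - 2 * kappa * (lin_comb a b w - mu * S).

Let mX i : measurable_fun setT (X ^~ i).
Proof.
case: i => [[n s]|] /=; last exact: measurable_sum_in.
by case: (s \in ys n) => //; exact: measurable_funD.
Qed.

Let mX' i : measurable_fun setT (X' ^~ i).
Proof.
case: i => [[n s]|]; first exact: (mX (Some (n, s))).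
apply: measurable_funB; first exact: (mX None).
by apply: measurable_funM => //; apply: measurable_funB => //; exact: measurable_lin_comb.
Qed.

Let u1 (t : option ('I_N * seg p) -> R) (s : seg p) : R :=
  t None * (s \in y)%:R + \sum_(n < N) t (Some (n, s)) * (s \in ys n)%:R.
Let v1 (t : option ('I_N * seg p) -> R) (n : 'I_N) (s : seg p) : R :=
  t (Some (n, s)) * (s \in ys n)%:R.

Let sum_option (F : option ('I_N * seg p) -> R) :
  \sum_i F i = F None + \sum_(n < N) \sum_s F (Some (n, s)).
Proof.
rewrite (bigD1 None)//=; congr (_ + _).
rewrite pair_bigA/=.
rewrite (reindex_omap Some id)/=; last by case.
by apply: eq_big => [[n s]|[n s] _] //=; rewrite eqxx.
Qed.

Let XE t w : \sum_i t i * X w i = lin_comb (u1 t) (v1 t) w.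
Proof.
rewrite sum_option /= /lin_comb /u1 /v1.
under [X in _ = X + _]eq_bigr do rewrite mulrDl.
rewrite big_split/= -addrA; congr (_ + _).
  rewrite big_mkcond mulr_sumr/=; apply: eq_bigr => s _.
  by case: (s \in y); rewrite ?mulr1// !mulr0 mul0r.
under [X in _ = X + _]eq_bigr do rewrite mulr_suml.
rewrite [X in _ = X + _]exchange_big/= -big_split/=; apply: eq_bigr => n _.
rewrite -big_split/=; apply: eq_bigr => s _.
by case: (s \in ys n); rewrite ?mulr1 ?mulrDr// !mulr0 !mul0r addr0.
Qed.

Let X'E t w : \sum_i t i * X' w i =
  lin_comb (fun s => u1 t s + - (2 * kappa * t None) * a s)
           (fun n s => v1 t n s + - (2 * kappa * t None) * b n s) w
  + 2 * kappa * t None * (mu * S).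
Proof.
rewrite lin_comb_shift -XE !sum_option /=; ring.
Qed.

(** Both functionals are Gaussian. Their means agree because the subtracted term is centered at
    [mu * S]; in the variance the cross term 2 x cov and the square x^2 var cancel exactly for x =
    -2 kappa t(None). *)
Let law_X (t : option ('I_N * seg p) -> R) (B : set R) :
  0 < lin_var a b -> measurable B ->
  P (A `&` (fun w => \sum_i t i * X w i) @^-1` B) =
  P (A `&` (fun w => \sum_i t i * X' w i) @^-1` B).
Proof.
move=> var_gt0 mB.
rewrite (_ : (fun w => \sum_i t i * X w i) = lin_comb (u1 t) (v1 t)); last first.
  by apply/funext => w; rewrite XE.
set x := - (2 * kappa * t None).
set c := 2 * kappa * t None * (mu * S).
rewrite (_ : (fun w => \sum_i t i * X' w i) @^-1` B =
   lin_comb (fun s => u1 t s + x * a s) (fun n s => v1 t n s + x * b n s)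
     @^-1` ((fun z => z + c) @^-1` B)); last first.
  by apply/seteqP; split => w /=; rewrite X'E.
have mB' : measurable ((fun z : R => z + c) @^-1` B).
  by rewrite -[X in measurable X]setTI; apply: measurable_funD.
rewrite !law// lin_var_shift cov_b.
have -> : \sum_s (u1 t s - \sum_(n < N) v1 t n s * (s \in ys n)%:R) * a s = t None * S.
  rewrite -sumaE mulr_sumr; apply: eq_bigr => s _.
  have -> : u1 t s - \sum_(n < N) v1 t n s * (s \in ys n)%:R = t None * (s \in y)%:R.
    rewrite /u1 /v1 -addrA -[RHS]addr0; congr (_ + _).
    rewrite -sumrB big1// => n _.
    by case: (s \in ys n); rewrite ?mulr1 ?subrr// !mulr0 subr0.
  by rewrite /a; case: (s \in y); rewrite ?mulr1// !mul0r !mulr0.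
have -> : lin_var (u1 t) (v1 t) + 2 * x * (tau2 * (t None * S)) + x ^+ 2 * lin_var a b =
    lin_var (u1 t) (v1 t).
  by rewrite /x /kappa; field; rewrite gt_eqF.
have -> : \sum_s (u1 t s + x * a s) = \sum_s u1 t s + x * S.
  by rewrite big_split/= -mulr_sumr sumaE.
rewrite !gauss_lawE ?lin_var_ge0//; congr (_ * normal_prob _ _ _)%E.
set q := lin_var _ _.
have E z : mu * (\sum_s u1 t s + x * S) + Num.sqrt q * z + c =
    mu * (\sum_s u1 t s) + Num.sqrt q * z by rewrite /x /c; ring.
by apply/seteqP; split => z /=; rewrite E.
Qed.

Let dat (x : option ('I_N * seg p) -> R) : N.-tuple (#|seg p|.-tuple R) :=
  [tuple [tuple x (Some (n, enum_val j)) | j < #|seg p|] | n < N].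

Let datX w : dat (X w) = trip_data w.
Proof.
apply: eq_from_tnth => n; rewrite !tnth_mktuple.
by apply: eq_from_tnth => j; rewrite !tnth_mktuple.
Qed.

Let datX' w : dat (X' w) = trip_data w.
Proof. by rewrite -datX. Qed.

Let measurable_dat :
  measurable_fun [set: g_sigma_algebraType (@coord_gt R (option ('I_N * seg p)))] dat.
Proof.
apply/measurable_fun_tnthP => n; apply/measurable_fun_tnthP => j.
rewrite (_ : _ \o _ = fun x => x (Some (n, enum_val j))); first exact: measurable_coord.
by apply/funext => x /=; rewrite !tnth_mktuple.
Qed.

(* [X'] is the image of [X] under the Gaussian reflection along [lin_comb a b];
   it has the same law and the same data, so by the parallelogram identity the
   mean squared error is at least that of half the displacement. *)
Lemma conditional_risk_ge (g : N.-tuple (#|seg p|.-tuple R) -> R) :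
  measurable_fun setT g ->
  ((k * (tau2 * S))%:E * normal_var R <=
   \int[P]_(w in A) ((g (trip_data w) - \sum_(s in y) theta w s) ^+ 2)%:E)%E.
Proof.
move=> mg.
have NV0 := ltW (normal_var_gt0 R).
(* For S = 0 the bound is trivial; otherwise some [a s] is nonzero, and the [theta] part alone makes
   the denominator of [kappa] positive. *)
have [S0|S0] := eqVneq S 0.
  by rewrite S0 !mulr0 mul0e integral_ge0// => w _; rewrite lee_fin sqr_ge0.
have S_gt0 : 0 < S.
  rewrite lt_neqAle eq_sym S0 /S /uncertainty sumr_ge0// => s _.
  by rewrite invr_ge0 ltW.
have var_gt0 : 0 < lin_var a b.
  rewrite (lt_le_trans _ (lin_var_ge a b))// mulr_gt0//.
  rewrite lt_neqAle sumr_ge0 ?andbT => [|s _]; last exact: sqr_ge0.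
  apply: contra_neq S0 => /esym/eqP.
  rewrite psumr_eq0 => [/allP h|s _]; last exact: sqr_ge0.
  rewrite -sumaE big1// => s _; apply/eqP; rewrite -sqrf_eq0.
  by apply: h; rewrite mem_index_enum.
pose h (x : g_sigma_algebraType (@coord_gt R (option ('I_N * seg p)))) : \bar R :=
  ((g (dat x) - x None) ^+ 2)%:E.
have mh : measurable_fun setT h.
  apply/measurable_EFinP; apply: measurable_funX; apply: measurable_funB.
    exact: (measurableT_comp mg measurable_dat).
  exact: measurable_coord.
have h0 x : (0 <= h x)%E by rewrite lee_fin sqr_ge0.
have hE : (\int[P]_(w in A) ((g (trip_data w) - \sum_(s in y) theta w s) ^+ 2)%:E =
    \int[P]_(w in A) h (X w))%E.
  by apply: eq_integral => w _; rewrite /h datX.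
have hX' := cramer_wold mA mX mX' (fun t B mB => law_X t var_gt0 mB) mh h0.
pose Z w := lin_comb a b w - mu * S.
have mZ : measurable_fun setT Z.
  by apply: measurable_funB => //; exact: measurable_lin_comb.
have mT := measurable_trip_data.
have mhX : measurable_fun setT (fun w => h (X w)).
  rewrite /h; apply/measurable_EFinP; apply: measurable_funX; apply: measurable_funB.
    by under eq_fun do rewrite datX; exact: (measurableT_comp mg mT).
  exact: (mX None).
have mhX' : measurable_fun setT (fun w => h (X' w)).
  rewrite /h; apply/measurable_EFinP; apply: measurable_funX; apply: measurable_funB.
    by under eq_fun do rewrite datX'; exact: (measurableT_comp mg mT).
  exact: (mX' None).
(* With q the error at [X], the error at [X'] is q + 2 kappa Z, and q^2 + (q + 2 kappa Z)^2 = 2 (q +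
   kappa Z)^2 + 2 kappa^2 Z^2. Equality of laws turns the two risks into twice the same one. *)
have key : ((2 * kappa ^+ 2)%:E * \int[P]_(w in A) (Z w ^+ 2)%:E <=
    \int[P]_(w in A) h (X w) + \int[P]_(w in A) h (X w))%E.
  rewrite {2}hX' -ge0_integralD//; last 2 first.
  - exact: measurable_funTS mhX.
  - exact: measurable_funTS mhX'.
  rewrite -ge0_integralZl//; last 3 first.
  - by apply: measurable_funTS; apply/measurable_EFinP; exact: measurable_funX.
  - by move=> w _; rewrite lee_fin sqr_ge0.
  - by rewrite lee_fin mulr_ge0// sqr_ge0.
  apply: ge0_le_integral => //.
  - by move=> w _; rewrite -EFinM lee_fin mulr_ge0 ?sqr_ge0// mulr_ge0// sqr_ge0.
  - apply: measurable_funTS; apply/measurable_EFinP; apply: measurable_funM => //.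
    exact: measurable_funX.
  - by apply: measurable_funTS; apply: emeasurable_funD.
  - move=> w _; rewrite /h datX datX' -EFinM -EFinD lee_fin /=.
    rewrite -/(Z w); set q := g _ - _.
    have -> : g (trip_data w) - (\sum_(s in y) theta w s - 2 * kappa * Z w) =
      q + 2 * kappa * Z w by rewrite /q; ring.
    have := sqr_ge0 (q + kappa * Z w).
    have -> : (q + kappa * Z w) ^+ 2 = q ^+ 2 + 2 * q * (kappa * Z w) + kappa ^+ 2 * Z w ^+ 2 by ring.
    have -> : (q + 2 * kappa * Z w) ^+ 2 = q ^+ 2 + 4 * q * (kappa * Z w) + 4 * (kappa ^+ 2 * Z w ^+ 2) by ring.
    by nra.
rewrite hE.
have lawab (B : set R) : measurable B ->
    P (A `&` lin_comb a b @^-1` B) = (k%:E * gauss_law (mu * S) (lin_var a b) B)%E.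
  by move=> mB; rewrite law// sumaE.
rewrite (gauss_law_var mA k_ge0 (lin_var_ge0 a b) (measurable_lin_comb a b) lawab) in key.
have : ((2 * (k * (tau2 * S)))%:E * normal_var R <=
   (2 * kappa ^+ 2)%:E * ((k * lin_var a b)%:E * normal_var R))%E.
  rewrite muleA -EFinM; apply: lee_wpmul2r => //; rewrite lee_fin.
  have -> : 2 * kappa ^+ 2 * (k * lin_var a b) = 2 * (k * (kappa ^+ 2 * lin_var a b)) by ring.
  rewrite ler_pM2l// ler_wpM2l//.
  (* The second factor is at least 1 by [var_le]: a small variance of the functional is what makes
     the bound strong. *)
  have -> : kappa ^+ 2 * lin_var a b = (tau2 * S) * ((tau2 * S) / lin_var a b).
    rewrite /kappa; set q := lin_var a b in var_gt0 *.
    have qn := lt0r_neq0 var_gt0.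
    by field.
  rewrite -[leLHS]mulr1 ler_pM2l ?mulr_gt0//.
  by rewrite ler_pdivlMr// mul1r.
move=> /le_trans /(_ key).
rewrite EFinM -muleA -mule2n -mule_natl.
by rewrite lee_pmul2l//.
Qed.

End LowerBound.

(** * Upper bound for segment-based estimators, given the routes *)

Section UpperBound.
Variables (phi : seg p -> nat -> R) (D Cs c : R).
Hypothesis phi0 : forall s, phi s 0%N = 0.
Hypothesis D_ge0 : 0 <= D.
Hypothesis phi_le : forall s n, (0 < n)%N -> `|1 - phi s n| <= D / Num.sqrt n%:R.
Hypothesis Cs_ge0 : 0 <= Cs.
Hypothesis Sigma_row : forall s, \sum_t `|Sigma s t| <= Cs.
Hypothesis c_ge0 : 0 <= c.

Let u (s : seg p) : R := - ((s \in y)%:R * (1 - phi s (hits s))).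
Let v (n : 'I_N) (s : seg p) : R :=
  (s \in y)%:R * (s \in ys n)%:R * (phi s (hits s) / (hits s)%:R).

(** The leading [tau2] pays for untraversed segments, estimated by the prior mean. In the bracket,
    [tau2 * D ^+ 2] pays for shrinkage and the other term for noise; the factor 1 + c converts 1/n
    into 1/(1 + c n). *)
Definition seg_cst : R := tau2 + (1 + c) * (tau2 * D ^+ 2 + Cs * (1 + D) ^+ 2).

(** On an untraversed segment the quotient is 0/0 = 0, which is harmless since [phi s 0] vanishes as
    well. *)
Let phi_hits s : phi s (hits s) * ((hits s)%:R / (hits s)%:R) = phi s (hits s).
Proof.
have [->|h0] := eqVneq (hits s) 0%N; first by rewrite phi0 mul0r.
by rewrite divff ?mulr1// pnatr_eq0.
Qed.

(** Segmentwise the error is (1 - phi)(mu - theta_s) plus phi times the averaged noise; the prior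
    mean in the estimator exactly centers it. *)
Let seg_est_err w :
  seg_est mu phi ys y (trip_data w) - \sum_(s in y) theta w s =
  lin_comb u v w - mu * \sum_s u s.
Proof.
rewrite /lin_comb exchange_big/= mulr_sumr -big_split/= -sumrB /seg_est -sumrB.
rewrite big_mkcond/=; apply: eq_bigr => s _.
rewrite /u /v; case: (s \in y); rewrite /= ?mulr1n ?mulr0n; last first.
  rewrite !mul0r oppr0 mulr0 subr0 mul0r add0r big1// => n _.
  by rewrite !mul0r.
under [in RHS]eq_bigr do rewrite !mul1r.
have -> : \sum_(n < N | s \in ys n) tnth (tnth (trip_data w) n) (enum_rank s) =
    (hits s)%:R * theta w s + \sum_(n < N) (s \in ys n)%:R * eps n w s.
  rewrite -hitsE mulr_suml -big_split/= big_mkcond/=; apply: eq_bigr => n _.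
  rewrite !tnth_mktuple enum_rankK.
  rewrite -[LHS]/(if s \in ys n then
    if s \in ys n then theta w s + eps n w s else 0 else 0).
  by case: (s \in ys n); rewrite /= ?mulr1n ?mulr0n ?mul1r// !mul0r addr0.
have -> : \sum_(n < N) (s \in ys n)%:R * (phi s (hits s) / (hits s)%:R) * eps n w s =
    (phi s (hits s) / (hits s)%:R) * \sum_(n < N) (s \in ys n)%:R * eps n w s.
  by rewrite mulr_sumr; apply: eq_bigr => n _; ring.
have := phi_hits s.
set x := phi s (hits s); set h := (hits s)%:R; set E := \sum_(n < N) _ => hx.
have -> : x * ((h * theta w s + E) / h) = (x * (h / h)) * theta w s + x / h * E by ring.
by rewrite hx; ring.
Qed.

(** The Schur test on [Sigma] decouples the segments. With n > 0 visits, (1 - phi)^2 <= D^2/n, and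
    averaging n trips leaves noise at most phi^2/n <= (1 + D)^2/n up to the row bound. *)
Let var_le : lin_var u v <= seg_cst * uncertainty c ys y.
Proof.
have h1 : lin_var u v <= tau2 * \sum_s u s ^+ 2 + \sum_(n < N) Cs * \sum_s v n s ^+ 2.
  apply: lerD; first by rewrite ler_pM2l//; apply: ler_sum => s _; rewrite expr2.
  by apply: ler_sum => n _; exact: quad_form_le.
apply: (le_trans h1).
rewrite -mulr_sumr exchange_big/= !mulr_sumr -big_split/= /uncertainty.
rewrite [leRHS]big_mkcond/=; apply: ler_sum => s _.
rewrite /u /v; case: (s \in y); rewrite /= ?mulr1n ?mulr0n; last first.
  rewrite mul0r oppr0 expr0n mulr0 add0r big1 ?mulr0// => n _.
  by rewrite !mul0r expr0n.
rewrite mul1r sqrrN.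
have -> : \sum_(n < N) (1 * (s \in ys n)%:R * (phi s (hits s) / (hits s)%:R)) ^+ 2 =
    (hits s)%:R * (phi s (hits s) / (hits s)%:R) ^+ 2.
  rewrite -hitsE mulr_suml; apply: eq_bigr => n _.
  by case: (s \in ys n); rewrite /= ?mulr1n ?mulr0n ?mul1r// !mul0r expr0n.
have K2_ge0 : 0 <= tau2 * D ^+ 2 + Cs * (1 + D) ^+ 2.
  by rewrite addr_ge0// mulr_ge0 ?sqr_ge0// ltW.
have [->|h0] := eqVneq (hits s) 0%N.
  rewrite phi0 subr0 expr1n mulr1 mulr0n !(mul0r, mulr0, addr0) invr1 mulr1.
  by rewrite /seg_cst lerDl mulr_ge0// addr_ge0.
set n := hits s in h0 *; rewrite -lt0n in h0.
have n1 : 1 <= n%:R :> R by rewrite ler1n.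
have n_gt0 : 0 < n%:R :> R by rewrite ltr0n.
have hphi := phi_le s h0.
have sqrtn : 1 <= Num.sqrt (n%:R : R) by rewrite -[leLHS]sqrtr1 ler_sqrt.
have e1 : (1 - phi s n) ^+ 2 <= D ^+ 2 / n%:R.
  rewrite -(real_normK (num_real _)) -[X in _ / X](sqr_sqrtr (ltW n_gt0)).
  by rewrite -expr_div_n lerXn2r// nnegrE// divr_ge0// sqrtr_ge0.
have e2 : phi s n ^+ 2 <= (1 + D) ^+ 2.
  rewrite -(real_normK (num_real _)) lerXn2r// ?nnegrE ?addr_ge0//.
  have -> : phi s n = 1 - (1 - phi s n) by ring.
  rewrite (le_trans (ler_normB _ _))// normr1 lerD2l (le_trans hphi)//.
  by rewrite ler_pdivrMr ?(lt_le_trans ltr01)// ler_peMr.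
have e3 : n%:R * (phi s n / n%:R) ^+ 2 = phi s n ^+ 2 / n%:R.
  by field; rewrite gt_eqF.
rewrite e3.
apply: (@le_trans _ _ ((tau2 * D ^+ 2 + Cs * (1 + D) ^+ 2) / n%:R)).
  have -> : (tau2 * D ^+ 2 + Cs * (1 + D) ^+ 2) / n%:R =
    tau2 * (D ^+ 2 / n%:R) + Cs * ((1 + D) ^+ 2 / n%:R) by ring.
  apply: lerD; first by rewrite ler_pM2l.
  by rewrite ler_wpM2l// ler_wpM2r// invr_ge0 ltW.
have den0 : 0 < 1 + c * n%:R by rewrite ltr_wpDr// mulr_ge0// ltW.
rewrite ler_pdivlMr// mulrAC ler_pdivrMr// /seg_cst.
(* This is where n >= 1 enters. *)
have : 1 + c * n%:R <= (1 + c) * n%:R by rewrite mulrDl mul1r lerD2r.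
move: K2_ge0; set K2 := tau2 * _ + _ => K2_ge0 hc.
apply: (le_trans (ler_wpM2l K2_ge0 hc)).
have -> : (tau2 + (1 + c) * K2) * n%:R = K2 * ((1 + c) * n%:R) + tau2 * n%:R by ring.
by rewrite lerDl mulr_ge0// ltW.
Qed.

Lemma conditional_risk_seg_le :
  (\int[P]_(w in A) ((seg_est mu phi ys y (trip_data w) -
                       \sum_(s in y) theta w s) ^+ 2)%:E <=
   (k * (seg_cst * uncertainty c ys y))%:E * normal_var R)%E.
Proof.
under eq_integral do rewrite seg_est_err.
rewrite (gauss_law_var mA k_ge0 (lin_var_ge0 u v) (measurable_lin_comb u v)); last first.
  by move=> B mB; exact: law.
apply: lee_wpmul2r; first exact: ltW (normal_var_gt0 R).
by rewrite lee_fin ler_wpM2l.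
Qed.

End UpperBound.
End ConditionalRisk.

(** * Integrated risk *)

Section TotalRisk.
Variables (R : realType) (p N : nat).
Variables (d : measure_display) (T : measurableType d) (P : probability T R).
Variables (Yh : 'I_N -> T -> {set seg p}) (Y : T -> {set seg p}).
Variables (theta : T -> seg p -> R) (eps : 'I_N -> T -> seg p -> R).
Variables (alpha mu tau2 : R) (Sigma : seg p -> seg p -> R).
Hypothesis model : trip_model P Yh Y theta eps alpha mu tau2 Sigma.

Local Notation cfg := (route_cfg p N * {set seg p})%type.

Definition cfg_weight (i : cfg) : R :=
  (\prod_(n < N) route_law alpha (i.1 n)) * route_law alpha i.2.

Definition cfg_event (i : cfg) : set T :=
  [set w | (forall n, Yh n w = i.1 n) /\ Y w = i.2].

Lemma measurable_cfg_event i : measurable (cfg_event i).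
Proof.
case: model => mYh mY _ _ _.
rewrite (_ : cfg_event i = \big[setI/setT]_(n < N) [set w | Yh n w = i.1 n] `&` [set w | Y w = i.2]).
  apply: measurableI => //; elim/big_ind: _ => //; exact: measurableI.
apply/seteqP; split => w /=.
  by move=> [h1 h2]; split => //; elim/big_ind: _ => // ? ?.
move=> [h1 h2]; split => // n; move: h1; rewrite (bigD1 n)//=.
by case.
Qed.

Lemma cfg_lawE i u v (B : set R) : measurable B ->
  P (cfg_event i `&` lin_comb theta eps u v @^-1` B) =
  ((cfg_weight i)%:E * gauss_law (mu * \sum_s u s) (lin_var tau2 Sigma u v) B)%E.
Proof. by case: model => _ _ _ _ law mB; rewrite [LHS]law. Qed.

Lemma cfg_weightE i : P (cfg_event i) = (cfg_weight i)%:E.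
Proof.
have := cfg_lawE i (fun=> 0) (fun _ _ => 0) (measurableT : measurable [set: R]).
rewrite preimage_setT setIT => ->; rewrite [X in (_ * X)%E](_ : _ = 1%E) ?mule1//.
by rewrite /gauss_law; case: ifP => _; [rewrite diracT|rewrite probability_setT].
Qed.

(** Read off from a probability, since the sign of [route_law] is not visible in its formula. *)
Lemma cfg_weight_ge0 i : 0 <= cfg_weight i.
Proof. by rewrite -lee_fin -cfg_weightE. Qed.

Lemma integral_cfg (F : cfg -> T -> R) :
  (forall i, measurable_fun setT (F i)) -> (forall i w, 0 <= F i w) ->
  (\int[P]_w (F (cfg_of Yh w, Y w) w)%:E =
   \sum_i \int[P]_(w in cfg_event i) (F i w)%:E)%E.
Proof.
move=> mF F0.
under [RHS]eq_bigr do rewrite integral_mkcond.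
rewrite -ge0_integral_sum//.
- apply: eq_integral => w _.
  rewrite (bigD1 (cfg_of Yh w, Y w))//= big1 ?adde0; last first.
    move=> [ys y] /eqP neq; rewrite patchE memNset// => -[/= h1 h2].
    apply: neq; rewrite h2; congr (_, _).
    by apply/ffunP => n; rewrite ffunE h1.
  by rewrite patchE mem_set//; split => //= n; rewrite ffunE.
- move=> i; apply/(measurable_restrictT _ (measurable_cfg_event i)).
  by apply: measurable_funTS; apply/measurable_EFinP.
- by move=> i w _; apply: erestrict_ge0 => x _; rewrite lee_fin.
Qed.

(** The route events partition the sample space. This identity is the source of all later facts on
    [route_law]: existence of the model forces total mass one. *)
Lemma sum_cfg_weight : \sum_i cfg_weight i = 1.
Proof.
have := integral_cfg (F := fun _ _ => 1 : R) (fun _ => @measurable_cst _ _ _ _ _ (1 : R))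
  (fun _ _ => ler01).
rewrite (_ : (\int[P]_w (1%R : R)%:E)%E = 1%E); last first.
  by rewrite (integral_cst P measurableT (1%:E : \bar R)) mul1e; exact: probability_setT.
move=> h; apply/EFin_inj; rewrite h -sumEFin; apply: eq_bigr => i _.
by rewrite (integral_cst P (measurable_cfg_event i) (1%:E : \bar R)) mul1e -cfg_weightE.
Qed.

Definition mean_uncertainty (c : R) : R :=
  \sum_i cfg_weight i * uncertainty c i.1 i.2.

Lemma uncertainty_ge0 (c : R) (i : cfg) : 0 <= c -> 0 <= uncertainty c i.1 i.2.
Proof.
move=> c0; apply: sumr_ge0 => s _.
by rewrite invr_ge0 addr_ge0// mulr_ge0.
Qed.

Lemma mean_uncertainty_ge0 c : 0 <= c -> 0 <= mean_uncertainty c.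
Proof.
move=> c0; apply: sumr_ge0 => i _.
by rewrite mulr_ge0 ?cfg_weight_ge0 ?uncertainty_ge0.
Qed.

Lemma risk_cfgE (est : route_cfg p N -> {set seg p} -> N.-tuple (#|seg p|.-tuple R) -> R) :
  (forall ys y, measurable_fun setT (est ys y)) ->
  risk P Yh Y theta eps est =
  (\sum_(i : cfg) \int[P]_(w in cfg_event i)
     ((est i.1 i.2 (trip_data theta eps i.1 w) - \sum_(s in i.2) theta w s) ^+ 2)%:E)%E.
Proof.
case: (model) => _ _ mtheta meps _ mest.
rewrite -(integral_cfg (F := fun i w => (est i.1 i.2 (trip_data theta eps i.1 w) -
   \sum_(s in i.2) theta w s) ^+ 2)); last 2 first.
- move=> i; apply: measurable_funX; apply: measurable_funB; last exact: measurable_sum_in.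
  by apply: (measurableT_comp (mest _ _)); exact: measurable_trip_data.
- by move=> i w; exact: sqr_ge0.
apply: eq_integral => w _; congr (((est _ _ _ - _) ^+ 2)%:E).
apply: eq_from_tnth => n; rewrite !tnth_mktuple.
by apply: eq_from_tnth => j; rewrite !tnth_mktuple ffunE.
Qed.

Lemma measurable_seg_est phi ys y :
  measurable_fun setT (seg_est (R := R) (p := p) (N := N) mu phi ys y).
Proof.
rewrite /seg_est; under eq_fun do rewrite big_mkcond/=.
apply: measurable_sum => s; case: (s \in y) => //.
apply: measurable_funD => //; apply: measurable_funM => //; apply: measurable_funM => //.
under eq_fun do rewrite big_mkcond/=.
apply: measurable_sum => n; case: (s \in ys n) => //.
exact: (measurableT_comp (measurable_tnth (enum_rank s)) (measurable_tnth n)).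
Qed.

Hypothesis tau2_gt0 : 0 < tau2.
Hypothesis Sigma_sym : forall s t, Sigma s t = Sigma t s.
Hypothesis Sigma_psd : forall v : seg p -> R,
  0 <= \sum_s \sum_t v s * Sigma s t * v t.

Lemma risk_ge (Psi : seg p -> seg p -> R) (C : R) est :
  (forall s u, \sum_t Sigma s t * Psi t u = (s == u)%:R) ->
  0 <= C -> (forall s, \sum_t `|Psi s t| <= C) ->
  (forall ys y, measurable_fun setT (est ys y)) ->
  ((tau2 * mean_uncertainty (tau2 * C))%:E * normal_var R <=
   risk P Yh Y theta eps est)%E.
Proof.
move=> SigmaPsi C0 Psi_row mest.
case: (model) => _ _ mtheta meps _.
rewrite risk_cfgE// /mean_uncertainty mulr_sumr -sumEFin ge0_sume_distrl; last first.
  move=> i _; rewrite lee_fin mulr_ge0 ?(ltW tau2_gt0)// mulr_ge0 ?cfg_weight_ge0//.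
  by rewrite uncertainty_ge0// mulr_ge0// ltW.
apply: lee_sum => i _; rewrite mulrCA.
apply: (conditional_risk_ge tau2_gt0 Sigma_sym Sigma_psd SigmaPsi) => //.
- exact: measurable_cfg_event.
- exact: cfg_weight_ge0.
- by move=> u v B; exact: cfg_lawE.
Qed.

Lemma risk_seg_le phi (D Cs c : R) :
  (forall s, phi s 0%N = 0) -> 0 <= D ->
  (forall s n, (0 < n)%N -> `|1 - phi s n| <= D / Num.sqrt n%:R) ->
  0 <= Cs -> (forall s, \sum_t `|Sigma s t| <= Cs) -> 0 <= c ->
  (risk P Yh Y theta eps (seg_est mu phi) <=
   (seg_cst tau2 D Cs c * mean_uncertainty c)%:E * normal_var R)%E.
Proof.
move=> phi0 D0 phi_le Cs0 Sigma_row c0.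
case: (model) => _ _ mtheta meps _.
have K0 : 0 <= seg_cst tau2 D Cs c.
  by have t0 := ltW tau2_gt0; rewrite /seg_cst !(addr_ge0, mulr_ge0, sqr_ge0).
rewrite risk_cfgE; last exact: measurable_seg_est.
rewrite /mean_uncertainty mulr_sumr -sumEFin ge0_sume_distrl; last first.
  move=> i _; rewrite lee_fin mulr_ge0// mulr_ge0 ?cfg_weight_ge0//.
  exact: uncertainty_ge0.
apply: lee_sum => i _; rewrite mulrCA.
apply: (conditional_risk_seg_le tau2_gt0 Sigma_sym Sigma_psd) => //.
- exact: measurable_cfg_event.
- exact: cfg_weight_ge0.
- by move=> u v B; exact: cfg_lawE.
Qed.

(* No segment has been traversed more than [N] times. *)
Lemma mean_uncertainty_ge (c : R) : 0 <= c ->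
  (1 + c * N%:R)^-1 * \sum_i cfg_weight i * #|i.2|%:R <= mean_uncertainty c.
Proof.
move=> c0; rewrite mulr_sumr; apply: ler_sum => i _.
rewrite mulrCA; apply: ler_wpM2l; first exact: cfg_weight_ge0.
rewrite /uncertainty -sum1_card natr_sum mulr_sumr; apply: ler_sum => s _.
rewrite mulr1 lef_pV2 ?posrE ?ltr_wpDr ?mulr_ge0//.
rewrite lerD2l ler_wpM2l// ler_nat.
by rewrite (leq_trans (max_card _))// card_ord.
Qed.

End TotalRisk.

(** * Length of a random route *)

Section RouteLength.
Variable p : nat.
Implicit Types (u v x : vtx p) (vs : seq (vtx p)).

Lemma l1dist_adj x u v : adjb (u, v) -> (l1dist x v <= (l1dist x u).+1)%N.
Proof. by rewrite /adjb /l1dist /distn /= => /eqP; lia. Qed.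

(** Discrete intermediate value argument: along the path the distance to [x] grows by at most one
    per step, so no level is skipped. *)
Lemma path_levels x u vs i : is_path u vs ->
  (l1dist x u < i <= l1dist x (last u vs))%N ->
  exists e, [/\ e \in zip (u :: vs) vs, adjb e & l1dist x e.2 = i].
Proof.
elim: vs u => [|v vs IH] u /=; first by move=> _; lia.
move=> /andP[uv pv] /andP[ui il].
have := l1dist_adj x uv; have [iv vu|vi _] := leqP i (l1dist x v).
  by exists (u, v); split => //=; [rewrite inE eqxx|lia].
have [|e [h1 h2 h3]] := IH v pv; first by rewrite vi.
by exists e; split => //; rewrite inE h1 orbT.
Qed.

(** Each distance 1, ..., L from [x] is attained by the head of some segment, and different
    distances mean different segments. *)
Lemma card_path_segs x vs : is_path x vs ->
  (l1dist x (last x vs) <= #|path_segs x vs|)%N.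
Proof.
move=> pxs; set L := l1dist _ _.
rewrite cardE -(size_map (fun s : seg p => l1dist x (val s).2)) -(size_iota 1 L).
apply: uniq_leq_size (iota_uniq _ _) _ => i; rewrite mem_iota add1n ltnS => /andP[i0 iL].
have [|e [h1 h2 h3]] := @path_levels x x vs i pxs.
  by rewrite iL andbT (leq_trans _ i0)// /l1dist /distn; lia.
apply/mapP; exists (exist _ e h2) => //.
by rewrite mem_enum inE.
Qed.

Lemma card_mt_route x1 x2 y : y \in mt_routes x1 x2 -> (l1dist x1 x2 <= #|y|)%N.
Proof.
move=> /imsetP[vs /andP[/andP[ps /eqP ls] _] ->].
by have := card_path_segs ps; rewrite ls.
Qed.

End RouteLength.

(** * Moments of the binomial distribution *)

Section Bernstein.
Variable R : realType.

Lemma sum_bernstein (p : nat) (x : R) :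
  \sum_(k < p.+1) 'C(p, k)%:R * x ^+ k * (1 - x) ^+ (p - k) = 1.
Proof.
have := exprDn (1 - x) x p; rewrite subrK expr1n => E; rewrite [RHS]E.
by apply: eq_bigr => k _; rewrite -[RHS]mulr_natl [X in _ = _ * X]mulrC mulrA.
Qed.

(** Absorption k C(p, k) = p C(p - 1, k - 1) reduces the first moment to the total mass at p - 1. *)
Lemma sum_bernstein_mul (p : nat) (x : R) :
  \sum_(k < p.+1) k%:R * ('C(p, k)%:R * x ^+ k * (1 - x) ^+ (p - k)) = p%:R * x.
Proof.
case: p => [|q]; first by rewrite big_ord1 !mul0r.
rewrite big_ord_recl mul0r add0r -[RHS]mulr1 -[X in _ = _ * X](sum_bernstein q x) mulr_sumr.
apply: eq_bigr => i _; rewrite lift0 subSS exprS.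
have E : (i.+1%:R * 'C(q.+1, i.+1)%:R : R) = q.+1%:R * 'C(q, i)%:R.
  by rewrite -!natrM -mul_bin_diag.
transitivity (i.+1%:R * 'C(q.+1, i.+1)%:R * (x * x ^+ i * (1 - x) ^+ (q - i))).
  by rewrite !mulrA.
by rewrite E; ring.
Qed.

(* Jensen's inequality for the binomial distribution. *)
Lemma sum_bernstein_sqr (p : nat) (x : R) : 0 <= x <= 1 ->
  (p%:R * x) ^+ 2 <=
  \sum_(k < p.+1) k%:R ^+ 2 * ('C(p, k)%:R * x ^+ k * (1 - x) ^+ (p - k)).
Proof.
move=> /andP[x0 x1].
pose b (k : 'I_p.+1) : R := 'C(p, k)%:R * x ^+ k * (1 - x) ^+ (p - k).
have b0 k : 0 <= b k by rewrite /b !mulr_ge0 ?exprn_ge0 ?subr_ge0.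
have s1 : \sum_k b k = 1 := sum_bernstein p x.
have s2 : \sum_(k < p.+1) k%:R * b k = p%:R * x := sum_bernstein_mul p x.
have : 0 <= \sum_(k < p.+1) (k%:R - p%:R * x) ^+ 2 * b k.
  by apply: sumr_ge0 => k _; rewrite mulr_ge0 ?sqr_ge0.
have -> : \sum_(k < p.+1) (k%:R - p%:R * x) ^+ 2 * b k =
   \sum_(k < p.+1) k%:R ^+ 2 * b k - 2 * (p%:R * x) * \sum_(k < p.+1) k%:R * b k
   + (p%:R * x) ^+ 2 * \sum_k b k.
  by rewrite !mulr_sumr -sumrB -big_split/=; apply: eq_bigr => k _; ring.
rewrite s1 s2; rewrite /b; lra.
Qed.

End Bernstein.

(** * Spread of the beta-binomial distribution *)

Section BetaBinomial.
Variables (R : realType) (alpha : R).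
Hypothesis beta_neq0 : betaR alpha alpha != 0.
Local Notation leb := (@lebesgue_measure R).
Local Notation D := (`]0%R, 1%R[%classic : set R).

Let w (x : R) : R := x `^ (alpha - 1) * (1 - x) `^ (alpha - 1).

Let w_ge0 x : 0 <= w x. Proof. by rewrite mulr_ge0 ?powR_ge0. Qed.

Let mw : measurable_fun setT w.
Proof.
apply: measurable_funM; first exact: measurable_powR.
by apply: (measurableT_comp (measurable_powR _)); apply: measurable_funB.
Qed.

(* Since [fine +oo = 0], a nonzero [betaR] forces the weight to be integrable. *)
Let w_int : leb.-integrable D (EFin \o w).
Proof.
apply/integrableP; split; first by apply/measurable_EFinP; exact: measurable_funTS.
rewrite (_ : (\int[leb]_(x in D) `|(EFin \o w) x|)%E = (\int[leb]_(x in D) (w x)%:E)%E).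
  have : (0 <= \int[leb]_(x in D) (w x)%:E)%E.
    by apply: integral_ge0 => x _; rewrite lee_fin.
  move: beta_neq0; rewrite /betaR /Rintegral.
  rewrite -[X in fine X]/(\int[leb]_(x in D) (w x)%:E)%E.
  by case: (\int[leb]_(x in D) (w x)%:E)%E => [r _ _| |]; rewrite ?ltry ?eqxx.
by apply: eq_integral => x _ /=; rewrite ger0_norm.
Qed.

(** Unnormalized expectation under the beta density; [m f / m (fun=> 1)] is the beta mean of [f]. *)
Let m (f : R -> R) : R := \int[leb]_(x in D) (f x * w x).

Let okf (f : R -> R) :=
  measurable_fun setT f /\ exists M : R, forall x, D x -> `|f x| <= M.

Let D01 x : D x -> 0 < x < 1. Proof. by rewrite /= in_itv/=. Qed.

Let mD : measurable (D : set (measurableTypeR R)). Proof. by []. Qed.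

Let okf_cst (c : R) : okf (fun=> c).
Proof. by split => //; exists `|c|. Qed.

Let okf_id : okf id.
Proof.
split; first exact: measurable_id.
by exists 1 => x /D01 /andP[x0 x1]; rewrite gtr0_norm ?ltW.
Qed.

Let okfD f g : okf f -> okf g -> okf (fun x => f x + g x).
Proof.
move=> [mf [M HM]] [mg [M' HM']]; split; first exact: measurable_funD.
by exists (M + M') => x Dx; rewrite (le_trans (ler_normD _ _))// lerD ?HM ?HM'.
Qed.

Let okfM f g : okf f -> okf g -> okf (fun x => f x * g x).
Proof.
move=> [mf [M HM]] [mg [M' HM']]; split; first exact: measurable_funM.
by exists (M * M') => x Dx; rewrite normrM ler_pM ?HM ?HM'.
Qed.

Let okfX n f : okf f -> okf (fun x => f x ^+ n).
Proof.
move=> hf; elim: n => [|n IH]; first exact: (okf_cst 1).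
by under eq_fun do rewrite exprS; exact: okfM.
Qed.

Let fint f : okf f -> leb.-integrable D (EFin \o (fun x => f x * w x)).
Proof.
move=> [mf [M HM]].
have h := integrableZl mD M w_int.
apply: (le_integrable mD _ _ h).
  by apply/measurable_EFinP/measurable_funTS; exact: measurable_funM.
move=> x Dx /=; rewrite lee_fin !normrM ler_wpM2r//.
by rewrite (le_trans (HM x Dx))// ler_norm.
Qed.

Let mDl f g : okf f -> okf g -> m (fun x => f x + g x) = m f + m g.
Proof.
move=> hf hg; rewrite /m -(RintegralD mD (fint hf) (fint hg)).
by apply: eq_Rintegral => x _; rewrite mulrDl.
Qed.

Let mZ c f : okf f -> m (fun x => c * f x) = c * m f.
Proof.
move=> hf; rewrite /m -(RintegralZl c mD (fint hf)).
by apply: eq_Rintegral => x _; rewrite mulrA.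
Qed.

Let m_sum n (a : 'I_n -> R) (f : 'I_n -> R -> R) : (forall k, okf (f k)) ->
  okf (fun x => \sum_k a k * f k x) /\
  m (fun x => \sum_k a k * f k x) = \sum_k a k * m (f k).
Proof.
move=> hf; elim: (index_enum _) => [|k s [IH1 IH2]].
  rewrite big_nil; under eq_fun do rewrite big_nil; split; first exact: okf_cst.
  transitivity (m (fun x => 0 * (fun=> 0) x)); last by rewrite (mZ 0 (okf_cst 0)) mul0r.
  by congr m; apply/funext => x; rewrite mul0r.
have hk : okf (fun x => a k * f k x) by apply: okfM => //; exact: okf_cst.
rewrite big_cons -IH2 -(mZ _ (hf k)) -mDl//.
by under eq_fun do rewrite big_cons; split => //; exact: okfD.
Qed.

Let m_le f g : okf f -> okf g -> (forall x, D x -> f x <= g x) -> m f <= m g.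
Proof.
move=> hf hg fg; apply: le_Rintegral mD (fint hf) (fint hg) _ => x Dx.
by apply: ler_wpM2r => //; exact: fg.
Qed.

(** One exceptional point [c] is allowed so that the lemma covers the squared deviation, which
    vanishes at the mean. *)
Let m_gt0 f (c : R) : okf f -> (forall x, D x -> 0 <= f x) ->
  (forall x, D x -> x != c -> 0 < f x) -> 0 < m f.
Proof.
move=> hf f0 fpos; rewrite lt_neqAle eq_sym Rintegral_ge0 ?andbT; last first.
  by move=> x Dx; rewrite mulr_ge0// f0.
apply/eqP => h.
have mfw : measurable_fun D (fun x => (f x * w x)%:E).
  by have /integrableP[] := fint hf.
have int0 : (\int[leb]_(x in D) `|(f x * w x)%:E| = 0)%E.
  rewrite (_ : (\int[leb]_(x in D) `|(f x * w x)%:E|)%E = (\int[leb]_(x in D) (f x * w x)%:E)%E).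
    by rewrite -[LHS](fineK (integrable_fin_num mD (fint hf))) -/(Rintegral _ _ _) -/(m f) h.
  by apply: eq_integral => x; rewrite inE => Dx; rewrite gee0_abs// lee_fin mulr_ge0// f0.
have [M [mM M0 hM]] := (ae_eq_integral_abs leb mD mfw).1 int0.
have mc : measurable [set c] by exact: measurable_set1.
have : (leb D <= leb (M `|` [set c]))%E.
  apply: le_measure; rewrite ?inE//; first exact: measurableU.
  move=> x Dx; have [->|xc] := eqVneq x c; first by right.
  left; apply: hM => /= /(_ Dx) [] /eqP.
  have /andP[x0 x1] := D01 Dx.
  by rewrite gt_eqF// mulr_gt0 ?fpos// mulr_gt0// powR_gt0// subr_gt0.
rewrite measureU0//; last exact: lebesgue_measure_set1.
by rewrite M0 lebesgue_measure_itv/= lte_fin ltr01 oppr0 adde0 leNgt lte_fin ltr01.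
Qed.

Let bern (p : nat) (k : 'I_p.+1) (x : R) : R := x ^+ k * (1 - x) ^+ (p - k).

Let okf_bern p k : okf (@bern p k).
Proof.
apply: okfM; first by apply: okfX; exact: okf_id.
apply: okfX; apply: okfD; first exact: okf_cst.
rewrite (_ : -%R = fun x : R => -1 * x); last by apply/funext => x; rewrite mulN1r.
by apply: okfM; [exact: okf_cst|exact: okf_id].
Qed.

Let powR_addn (x a : R) n : 0 < x -> x `^ (a + n%:R - 1) = x ^+ n * x `^ (a - 1).
Proof.
move=> x0; rewrite -powR_mulrn ?ltW// -powRD; last by rewrite (gt_eqF x0) implybT.
by congr (_ `^ _); ring.
Qed.

Let m1E : m (fun=> 1) = betaR alpha alpha.
Proof. by apply: eq_Rintegral => x _; rewrite mul1r. Qed.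

Let m1_gt0 : 0 < m (fun=> 1).
Proof. exact: (@m_gt0 _ 0 (okf_cst 1)). Qed.

(** Shifting the beta exponents amounts to inserting x^k (1 - x)^(p - k): the coordinate law is a
    binomial whose parameter has a beta law. *)
Let coord_lawE p (k : 'I_p.+1) :
  coord_law alpha p k = 'C(p, k)%:R * m (@bern p k) / m (fun=> 1).
Proof.
rewrite /coord_law m1E; congr (_ * _ / _); apply: eq_Rintegral => x.
rewrite inE => /D01/andP[x0 x1].
by rewrite !powR_addn ?subr_gt0// /bern /w; ring.
Qed.

Lemma coord_law_ge0 p (k : 'I_p.+1) : 0 <= coord_law alpha p k.
Proof.
rewrite coord_lawE divr_ge0 ?(ltW m1_gt0)// mulr_ge0//.
apply: Rintegral_ge0 => x /D01/andP[x0 x1].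
by rewrite mulr_ge0// mulr_ge0 ?exprn_ge0// ?subr_ge0 ltW.
Qed.

Let sum_coord_law p (a : 'I_p.+1 -> R) :
  \sum_k a k * coord_law alpha p k =
  m (fun x => \sum_k (a k * 'C(p, k)%:R) * bern k x) / m (fun=> 1).
Proof.
rewrite (m_sum (fun k => a k * 'C(p, k)%:R) (@okf_bern p)).2 mulr_suml.
by apply: eq_bigr => k _; rewrite coord_lawE; ring.
Qed.

Lemma coord_law_sum p : \sum_(k < p.+1) coord_law alpha p k = 1.
Proof.
under eq_bigr do rewrite -[coord_law _ _ _]mul1r.
rewrite (sum_coord_law (fun=> 1)).
transitivity (m (fun=> 1) / m (fun=> 1)); last by rewrite divff// gt_eqF.
congr (m _ / _); apply/funext => x; rewrite -[RHS](sum_bernstein p x).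
by apply: eq_bigr => k _; rewrite mul1r mulrA.
Qed.

Let mu1 : R := m id / m (fun=> 1).
Let mu2 : R := m (fun x => x ^+ 2) / m (fun=> 1).

(* The variance of the beta distribution. *)
Definition beta_spread : R := mu2 - mu1 ^+ 2.

Lemma beta_spread_gt0 : 0 < beta_spread.
Proof.
have ok2 : okf (fun x => x ^+ 2) by apply: okfX; exact: okf_id.
have okd : okf (fun x => (x - mu1) ^+ 2).
  by apply: okfX; apply: okfD; [exact: okf_id|exact: okf_cst].
have := m_gt0 (c := mu1) okd (fun x _ => sqr_ge0 _).
have -> : m (fun x => (x - mu1) ^+ 2) = beta_spread * m (fun=> 1).
  rewrite (_ : (fun x => _) = (fun x => x ^+ 2 + (- (2 * mu1) * x + mu1 ^+ 2 * 1))); last first.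
    by apply/funext => x; ring.
  have ok1 : okf (fun x => - (2 * mu1) * x) by apply: okfM; [exact: okf_cst|exact: okf_id].
  have okc : okf (fun x => mu1 ^+ 2 * 1) by exact: okf_cst.
  rewrite mDl//; last exact: okfD.
  rewrite mDl// (mZ _ okf_id) (mZ _ (okf_cst 1)).
  rewrite /beta_spread /mu1 /mu2; field.
  by rewrite gt_eqF.
rewrite pmulr_lgt0//; apply => x _ xm.
by rewrite exprn_even_gt0//= subr_eq0.
Qed.

(** Since |k - l| <= p, one has |k - l| >= (k - l)^2/p. For independent k and l the mean of (k -
    l)^2 is twice the variance, and by Jensen the variance is at least p^2 times the beta
    variance. *)
Lemma coord_law_dist p :
  2 * beta_spread * p%:R <=
  \sum_(k < p.+1) \sum_(l < p.+1)
    coord_law alpha p k * coord_law alpha p l * (distn k l)%:R.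
Proof.
have [->|p0] := eqVneq p 0%N.
  rewrite mulr0; apply: sumr_ge0 => k _; apply: sumr_ge0 => l _.
  by apply: mulr_ge0 => //; apply: mulr_ge0; exact: coord_law_ge0.
have pgt : 0 < p%:R :> R by rewrite ltr0n lt0n.
pose c (k : 'I_p.+1) := coord_law alpha p k.
have s1 : \sum_k c k = 1 := coord_law_sum p.
have s2 : \sum_(k < p.+1) k%:R * c k = p%:R * mu1.
  rewrite (sum_coord_law (fun k => k%:R)) /mu1 mulrA -(mZ _ okf_id).
  congr (m _ / _); apply/funext => x; rewrite -[RHS]sum_bernstein_mul.
  by apply: eq_bigr => k _; rewrite /bern !mulrA.
have s3 : p%:R ^+ 2 * mu2 <= \sum_(k < p.+1) k%:R ^+ 2 * c k.
  rewrite (sum_coord_law (fun k => k%:R ^+ 2)) /mu2 mulrA -mZ; last by apply: okfX; exact: okf_id.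
  rewrite ler_pM2r ?invr_gt0//; apply: m_le.
  - by apply: okfM; [exact: okf_cst|apply: okfX; exact: okf_id].
  - by case: (m_sum (fun k => k%:R ^+ 2 * 'C(p, k)%:R) (@okf_bern p)).
  move=> x /D01/andP[x0 x1]; rewrite -exprMn.
  apply: (le_trans (sum_bernstein_sqr p _)); first by rewrite !ltW.
  by rewrite le_eqVlt; apply/orP; left; apply/eqP; apply: eq_bigr => k _; rewrite /bern !mulrA.
have dist_ge (k l : 'I_p.+1) : (k%:R - l%:R) ^+ 2 / p%:R <= (distn k l)%:R :> R.
  rewrite ler_pdivrMr//.
  have -> : (k%:R - l%:R) ^+ 2 = (distn k l)%:R ^+ 2 :> R.
    rewrite /distn; have [kl|/ltnW lk] := leqP k l.
      by rewrite (eqP kl) add0n natrB// -sqrrN opprB.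
    by rewrite (eqP lk) addn0 natrB.
  rewrite expr2 ler_wpM2l// ler_nat /distn.
  by have := ltn_ord k; have := ltn_ord l; lia.
apply: (@le_trans _ _ (\sum_(k < p.+1) \sum_(l < p.+1) c k * c l * ((k%:R - l%:R) ^+ 2 / p%:R))); last first.
  apply: ler_sum => k _; apply: ler_sum => l _.
  by apply: ler_wpM2l; [rewrite mulr_ge0// coord_law_ge0|exact: dist_ge].
have -> : \sum_(k < p.+1) \sum_(l < p.+1) c k * c l * ((k%:R - l%:R) ^+ 2 / p%:R) =
   (2 * (\sum_(k < p.+1) k%:R ^+ 2 * c k) * (\sum_k c k) - 2 * (\sum_(k < p.+1) k%:R * c k) ^+ 2) / p%:R.
  have -> : 2 * (\sum_(k < p.+1) k%:R ^+ 2 * c k) * (\sum_k c k) =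
    (\sum_(k < p.+1) k%:R ^+ 2 * c k) * (\sum_k c k) + (\sum_k c k) * (\sum_(k < p.+1) k%:R ^+ 2 * c k) by ring.
  have -> : 2 * (\sum_(k < p.+1) k%:R * c k) ^+ 2 =
    2 * ((\sum_(k < p.+1) k%:R * c k) * (\sum_(k < p.+1) k%:R * c k)) by ring.
  rewrite !mulr_suml mulr_sumr -big_split -sumrB mulr_suml /=; apply: eq_bigr => k _.
  rewrite !mulr_sumr -big_split -sumrB mulr_suml /=; apply: eq_bigr => l _; ring.
rewrite s1 s2 mulr1 ler_pdivlMr// /beta_spread.
have -> : 2 * (mu2 - mu1 ^+ 2) * p%:R * p%:R = 2 * (p%:R ^+ 2 * mu2) - 2 * (p%:R * mu1) ^+ 2 by ring.
by rewrite lerD2r ler_pM2l.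
Qed.

End BetaBinomial.

(** * Mean length of a route *)

Section MeanLength.
Variables (R : realType) (alpha : R) (p N : nat).
Local Notation v := (@vtx_law R alpha p).
Local Notation law := (@route_law R alpha p).
Local Notation mt := (@mt_routes p).

Hypothesis mass : \sum_(i : route_cfg p N * {set seg p}) cfg_weight alpha i = 1.

Let den : R := 1 - \sum_x v x ^+ 2.

Let sum_cfg (f : {set seg p} -> R) :
  \sum_(i : route_cfg p N * {set seg p}) cfg_weight alpha i * f i.2 =
  (\sum_y law y) ^+ N * \sum_y law y * f y.
Proof.
rewrite -[in RHS](card_ord N) -prodr_const bigA_distr_bigA/= mulr_suml.
rewrite /cfg_weight -(pair_bigA _ (fun (ys : route_cfg p N) y =>
  (\prod_(n < N) law (ys n)) * law y * f y))/=.
apply: eq_bigr => ys _; rewrite mulr_sumr.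
by apply: eq_bigr => y _; rewrite mulrA.
Qed.

Let law_pow : (\sum_y law y) ^+ N.+1 = 1.
Proof.
rewrite -[RHS]mass exprSr.
have := sum_cfg (fun=> 1).
by rewrite (eq_bigr _ (fun i _ => mulr1 _)) (eq_bigr _ (fun y _ => mulr1 _)) => ->.
Qed.

Let sum_law (f : {set seg p} -> R) : \sum_y law y * f y =
  (\sum_x1 \sum_(x2 | x1 != x2) v x1 * v x2 *
     ((\sum_(y in mt x1 x2) f y) / #|mt x1 x2|%:R)) / den.
Proof.
rewrite /route_law -/den.
under eq_bigr do rewrite mulrAC mulr_suml.
rewrite -mulr_suml exchange_big/=; congr (_ / _); apply: eq_bigr => x1 _.
under eq_bigr do rewrite mulr_suml.
rewrite exchange_big/=; apply: eq_bigr => x2 _.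
rewrite mulr_suml mulr_sumr [RHS]big_mkcond/=; apply: eq_bigr => y _.
by case: (y \in mt x1 x2); rewrite /= ?mulr1n ?mulr0n; [ring|rewrite mul0r mulr0 mul0r].
Qed.

Let law_neq0 : \sum_y law y != 0.
Proof.
by apply: contra_eq_neq law_pow => ->; rewrite expr0n/= eq_sym oner_neq0.
Qed.

(** With a zero beta constant, division by zero would make [vtx_law] vanish identically and the
    route law would carry no mass. *)
Lemma betaR_neq0 : betaR alpha alpha != 0.
Proof.
apply: contraNneq law_neq0 => b0.
have v0 x : v x = 0 by rewrite /vtx_law /coord_law b0 invr0 !mulr0.
under eq_bigr do rewrite -[law _]mulr1.
rewrite (sum_law (fun=> 1)) big1 ?mul0r// => x1 _; rewrite big1// => x2 _.
by rewrite v0 !mul0r.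
Qed.

Let v_ge0 x : 0 <= v x.
Proof. by rewrite mulr_ge0 ?coord_law_ge0// betaR_neq0. Qed.

Let sum_v (f : 'I_p.+1 -> R) : \sum_x v x * f x.1 = \sum_(k < p.+1) coord_law alpha p k * f k.
Proof.
rewrite /vtx_law.
rewrite -(pair_bigA _ (fun i j : 'I_p.+1 => coord_law alpha p i * coord_law alpha p j * f i))/=.
apply: eq_bigr => i _; rewrite -[RHS]mulr1 -[X in _ = _ * X](coord_law_sum betaR_neq0 p).
by rewrite mulr_sumr; apply: eq_bigr => j _; ring.
Qed.

Let sum_v1 : \sum_x v x = 1.
Proof.
under eq_bigr do rewrite -[v _]mulr1.
rewrite (sum_v (fun=> 1)) -[RHS](coord_law_sum betaR_neq0 p).
by apply: eq_bigr => k _; rewrite mulr1.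
Qed.

Let den_neq : den = \sum_x1 \sum_(x2 | x1 != x2) v x1 * v x2.
Proof.
have : (\sum_x v x) * (\sum_x v x) = 1 by rewrite sum_v1 mulr1.
rewrite /den => <-; rewrite mulr_suml -sumrB; apply: eq_bigr => x1 _.
rewrite mulr_sumr (bigD1 x1)//= expr2 addrAC subrr add0r.
by apply: eq_bigl => x2; rewrite eq_sym.
Qed.

(** It is a sum of nonnegative off-diagonal products; if it were 0, division by it would again
    annihilate the route law. *)
Let den_gt0 : 0 < den.
Proof.
rewrite lt_neqAle eq_sym; apply/andP; split.
  apply: contraNneq law_neq0 => d0.
  under eq_bigr do rewrite -[law _]mulr1.
  by rewrite (sum_law (fun=> 1)) d0 invr0 mulr0.
rewrite den_neq; apply: sumr_ge0 => x1 _; apply: sumr_ge0 => x2 _.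
exact: mulr_ge0.
Qed.

Let den_le1 : den <= 1.
Proof. by rewrite lerBlDr lerDl sumr_ge0// => x _; exact: sqr_ge0. Qed.

Let mt_mean1 x1 x2 : (\sum_(y in mt x1 x2) (1 : R)) / #|mt x1 x2|%:R = (#|mt x1 x2| != 0)%:R.
Proof.
rewrite sumr_const; case: eqP => [->|/eqP h]; first by rewrite invr0 mulr0.
by rewrite divff// pnatr_eq0.
Qed.

(** The mass of N + 1 independent routes is a power of this sum, and a nonnegative real with a
    positive power equal to 1 is 1. *)
Let law_sum1 : \sum_y law y = 1.
Proof.
have : 0 <= \sum_y law y.
  under eq_bigr do rewrite -[law _]mulr1.
  rewrite (sum_law (fun=> 1)) divr_ge0 ?(ltW den_gt0)//.
  apply: sumr_ge0 => x1 _; apply: sumr_ge0 => x2 _.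
  by rewrite mt_mean1 mulr_ge0// mulr_ge0.
by move=> h; apply/eqP; rewrite -(pexpr_eq1 (ltn0Sn N) h) law_pow.
Qed.

(* The routes carry total mass one, so almost every origin-destination pair
   admits a minimum-turn route. *)
Let mt_ae x1 x2 : x1 != x2 -> v x1 * v x2 * (#|mt x1 x2| != 0)%:R = v x1 * v x2.
Proof.
move=> x12.
pose g x1 x2 := v x1 * v x2 - v x1 * v x2 * (#|mt x1 x2| != 0)%:R.
have g0 a b : 0 <= g a b.
  rewrite /g subr_ge0 -[leRHS]mulr1; apply: ler_wpM2l; first exact: mulr_ge0.
  by rewrite lern1 leq_b1.
have : \sum_x1 \sum_(x2 | x1 != x2) g x1 x2 = 0.
  under eq_bigr do rewrite sumrB.
  rewrite sumrB -den_neq.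
  have := law_sum1; under eq_bigr do rewrite -[law _]mulr1.
  rewrite (sum_law (fun=> 1)) => /(congr1 (fun z => z * den)).
  rewrite divfK ?gt_eqF// mul1r => <-; apply/eqP; rewrite subr_eq0; apply/eqP.
  by apply: eq_bigr => a _; apply: eq_bigr => b _; rewrite mt_mean1.
move=> /eqP; rewrite psumr_eq0 => [/allP/(_ x1 (mem_index_enum _))/=|a _]; last exact: sumr_ge0.
rewrite psumr_eq0// => /allP/(_ x2 (mem_index_enum _))/=.
by rewrite x12/= subr_eq0 => /eqP.
Qed.

(** A route has at least as many segments as the first coordinates of its endpoints are apart.
    Excluding equal endpoints discards only zero distances, and dividing by [den] <= 1 can only
    enlarge the mean. *)
Lemma mean_route_length :
  2 * beta_spread alpha * p%:R <=
  \sum_(i : route_cfg p N * {set seg p}) cfg_weight alpha i * #|i.2|%:R.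
Proof.
rewrite (sum_cfg (fun y => #|y|%:R)) law_sum1 expr1n mul1r sum_law.
have len_ge x1 x2 : x1 != x2 -> v x1 * v x2 * (distn x1.1 x2.1)%:R <=
   v x1 * v x2 * ((\sum_(y in mt x1 x2) #|y|%:R) / #|mt x1 x2|%:R).
  move=> x12; rewrite -[X in X * (distn _ _)%:R](mt_ae x12) -mulrA.
  apply: ler_wpM2l; first exact: mulr_ge0.
  rewrite -mt_mean1 mulrAC ler_wpM2r ?invr_ge0// mulr_suml.
  apply: ler_sum => y /card_mt_route ly; rewrite mul1r ler_nat.
  by rewrite (leq_trans _ ly)// leq_addr.
apply: (@le_trans _ _ (\sum_x1 \sum_(x2 | x1 != x2) v x1 * v x2 * (distn x1.1 x2.1)%:R)).
  have -> : \sum_x1 \sum_(x2 | x1 != x2) v x1 * v x2 * (distn x1.1 x2.1)%:R =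
      \sum_x1 v x1 * \sum_x2 v x2 * (distn x1.1 x2.1)%:R.
    apply: eq_bigr => x1 _; rewrite mulr_sumr [RHS](bigD1 x1)//=.
    have -> : distn x1.1 x1.1 = 0%N by rewrite /distn subnn.
    rewrite !mulr0 add0r.
    by apply: eq_big => [x2|x2 _]; [rewrite eq_sym|rewrite mulrA].
  have E (x1 : vtx p) : \sum_x2 v x2 * (distn x1.1 x2.1)%:R =
     \sum_(l < p.+1) coord_law alpha p l * (distn x1.1 l)%:R.
    exact: (sum_v (fun l => (distn x1.1 l)%:R)).
  under [leRHS]eq_bigr do rewrite E.
  rewrite (sum_v (fun k => \sum_(l < p.+1) coord_law alpha p l * (distn k l)%:R)).
  apply: (le_trans (coord_law_dist betaR_neq0 p)).
  apply: ler_sum => k _; rewrite mulr_sumr; apply: ler_sum => l _.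
  by rewrite mulrA.
set A := leRHS; set B := leLHS.
have B0 : 0 <= B.
  by apply: sumr_ge0 => x1 _; apply: sumr_ge0 => x2 _; rewrite mulr_ge0// mulr_ge0.
have : B <= A * den.
  rewrite /A divfK ?gt_eqF//; apply: ler_sum => x1 _; apply: ler_sum => x2.
  exact: len_ge.
move=> /le_trans; apply; rewrite -[leRHS]mulr1; apply: ler_wpM2l => //.
rewrite -(@pmulr_lge0 _ den)//.
by apply: (le_trans B0); rewrite /A divfK ?gt_eqF//; apply: ler_sum => x1 _;
  apply: ler_sum => x2; exact: len_ge.
Qed.

End MeanLength.

(** * Asymptotic comparison of the integrated risks *)

Theorem theorem3p2 (R : realType) (alpha mu tau2 : R) (N : nat -> nat)
    (Sigma Psi : forall p : nat, seg p -> seg p -> R)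
    (d : nat -> measure_display) (T : forall p : nat, measurableType (d p))
    (P : forall p : nat, probability (T p) R)
    (Yh : forall p : nat, 'I_(N p) -> T p -> {set seg p})
    (Y : forall p : nat, T p -> {set seg p})
    (theta : forall p : nat, T p -> seg p -> R)
    (eps : forall p : nat, 'I_(N p) -> T p -> seg p -> R) :
  0 < alpha <= 1 ->
  0 < tau2 ->
  (* N = N(p) -> oo *)
  (forall M : nat, exists p0 : nat, forall p : nat, (p0 <= p)%N -> (M <= N p)%N) ->
  (* the model, for every nontrivial grid *)
  (forall p : nat, (0 < p)%N ->
     trip_model (P p) (Yh p) (Y p) (theta p) (eps p) alpha mu tau2 (Sigma p)) ->
  (* Sigma_p is a covariance matrix and Psi_p = Sigma_p^-1 *)
  (forall p s t, Sigma p s t = Sigma p t s) ->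
  (forall p (v : seg p -> R), 0 <= \sum_s \sum_t v s * Sigma p s t * v t) ->
  (forall p s u, \sum_t Sigma p s t * Psi p t u = (s == u)%:R) ->
  (forall p s u, \sum_t Psi p s t * Sigma p t u = (s == u)%:R) ->
  (* uniform row-sum bounds *)
  (exists C : R, forall p s, \sum_t `|Sigma p s t| <= C) ->
  (exists C : R, forall p s, \sum_t `|Psi p s t| <= C) ->
  (exists smin : R, 0 < smin /\
     forall p (y : {set seg p}), is_route y ->
       smin <= \sum_(s in y) \sum_(t in y) Sigma p s t) ->
  (* (1) *)
  (1 / 2 <= alpha ->
   (* N = omega(p) *)
   (forall M : R, exists p0 : nat, forall p : nat, (p0 <= p)%N ->
       M * p%:R <= (N p)%:R) ->
   forall phi : forall p : nat, seg p -> nat -> R,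
     (forall p s, phi p s 0%N = 0) ->
     (exists C : R, forall p s (n : nat), (0 < n)%N ->
        `|1 - phi p s n| <= C / Num.sqrt n%:R) ->
     exists (C : R) (p0 : nat), forall p : nat, (p0 <= p)%N ->
       (risk (P p) (Yh p) (Y p) (theta p) (eps p) (seg_est mu (phi p))
        <= (C * ln p%:R)%:E * opt_risk (P p) (Yh p) (Y p) (theta p) (eps p))%E)
  /\
  (* (2) *)
  ((exists (C : R) (p0 : nat), forall p : nat, (p0 <= p)%N -> (N p)%:R <= C * p%:R) ->
   forall est : forall p : nat, route_cfg p (N p) -> {set seg p} ->
                  (N p).-tuple (#|seg p|.-tuple R) -> R,
     (forall p ys y, measurable_fun [set: (N p).-tuple (#|seg p|.-tuple R)] (est p ys y)) ->
     exists c : R, 0 < c /\ exists p0 : nat, forall p : nat, (p0 <= p)%N ->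
       (c%:E <= risk (P p) (Yh p) (Y p) (theta p) (eps p) (est p))%E).
Proof.
move=> _ tau2_gt0 _ model Sigma_sym Sigma_psd SigmaPsi _ [CS Sigma_row] [CP Psi_row] _.
have Sigma_row' p s : \sum_t `|Sigma p s t| <= `|CS| := le_trans (Sigma_row p s) (ler_norm _).
have Psi_row' p s : \sum_t `|Psi p s t| <= `|CP| := le_trans (Psi_row p s) (ler_norm _).
(* The lower bound dictates this constant; the upper bound holds for any nonnegative one, so both
   risks are measured by the same [U p]. *)
pose c := tau2 * `|CP|.
have c_ge0 : 0 <= c by rewrite mulr_ge0// ltW.
have NV_gt0 := normal_var_gt0 R.
pose U p := mean_uncertainty p (N p) alpha c.
have lower p : (0 < p)%N -> forall est : route_cfg p (N p) -> {set seg p} ->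
      (N p).-tuple (#|seg p|.-tuple R) -> R,
    (forall ys y, measurable_fun [set: (N p).-tuple (#|seg p|.-tuple R)] (est ys y)) ->
    ((tau2 * U p)%:E * normal_var R <=
     risk (P p) (Yh p) (Y p) (theta p) (eps p) est)%E.
  move=> p0 est mest.
  exact: (risk_ge (model p p0) tau2_gt0 (Sigma_sym p) (Sigma_psd p) (SigmaPsi p)).
split.
  move=> _ _ phi phi0 [D phi_le].
  have phi_le' p s n : (0 < n)%N -> `|1 - phi p s n| <= `|D| / Num.sqrt n%:R.
    move=> n0; apply: (le_trans (phi_le p s n n0)).
    by rewrite ler_wpM2r ?invr_ge0 ?sqrtr_ge0// ler_norm.
  pose K := seg_cst tau2 `|D| `|CS| c.
  have K_ge0 : 0 <= K.
    by have t0 := ltW tau2_gt0; rewrite /K /seg_cst !(addr_ge0, mulr_ge0, sqr_ge0).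
  have ln2_gt0 : 0 < ln (2 : R) by rewrite ln_gt0// ltr1n.
  (* The ratio is bounded by K / tau2; dividing by ln 2 makes C ln p at least that for all p >=
     2. *)
  exists (K / tau2 / ln 2), 2%N => p p2.
  have p_gt0 : (0 < p)%N by rewrite (leq_trans _ p2).
  set opt := opt_risk _ _ _ _ _.
  have opt_ge : ((tau2 * U p)%:E * normal_var R <= opt)%E.
    by apply: le_ereal_inf_tmp => _ [est mest <-]; exact: lower.
  have opt_ge0 : (0 <= opt)%E.
    apply: le_trans opt_ge; rewrite mule_ge0 ?(ltW NV_gt0)// lee_fin.
    by rewrite mulr_ge0 ?(ltW tau2_gt0)// (mean_uncertainty_ge0 (model p p_gt0)).
  apply: (@le_trans _ _ ((K * U p)%:E * normal_var R)%E).
    exact: (risk_seg_le (model p p_gt0) tau2_gt0 (Sigma_sym p) (Sigma_psd p)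
      (phi0 p) (normr_ge0 D) (@phi_le' p) (normr_ge0 CS) (Sigma_row' p) c_ge0).
  have -> : K * U p = K / tau2 * (tau2 * U p) by field; rewrite gt_eqF.
  rewrite EFinM -muleA.
  apply: (@le_trans _ _ ((K / tau2)%:E * opt)%E).
    by rewrite lee_wpmul2l// lee_fin divr_ge0// ltW.
  apply: lee_wpmul2r => //; rewrite lee_fin -mulrA.
  rewrite -[leLHS]mulr1; apply: ler_wpM2l; first by rewrite divr_ge0// ltW.
  rewrite mulrC ler_pdivlMr// mul1r ler_ln ?posrE ?ltr0n//.
  by rewrite ler_nat.
move=> [C [p0 N_le]] est mest.
(* The beta constant does not depend on p, so the grid p = 1 suffices to show that it is nonzero. *)
have beta0 := betaR_neq0 (sum_cfg_weight (model 1%N isT)).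
have spread_gt0 := beta_spread_gt0 beta0.
pose r := tau2 * (2 * beta_spread alpha) / (1 + c * `|C|).
have den_gt0 : 0 < 1 + c * `|C| by rewrite ltr_wpDr// mulr_ge0.
have r_gt0 : 0 < r by rewrite divr_gt0// !mulr_gt0.
(* A real constant is required, while [normal_var] is an extended real: pick a positive real below
   it. *)
have [z [z_gt0 z_le]] : exists z : R, 0 < z /\ (z%:E <= normal_var R)%E.
  move: NV_gt0; case: (normal_var R) => [z| |] //; first by rewrite lte_fin; exists z.
  by exists 1; rewrite ltr01 leey.
exists (r * z); split; first exact: mulr_gt0.
exists (maxn p0 1) => p; rewrite geq_max => /andP[p0p p_gt0].
apply: le_trans (lower p p_gt0 (est p) (mest p)).
apply: (@le_trans _ _ (r%:E * normal_var R)%E).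
  by rewrite EFinM lee_wpmul2l// lee_fin ltW.
apply: lee_wpmul2r; first exact: ltW.
rewrite lee_fin /r -mulrA ler_pM2l//.
apply: le_trans (mean_uncertainty_ge (model p p_gt0) c_ge0).
have denN_gt0 : 0 < 1 + c * (N p)%:R by rewrite ltr_wpDr// mulr_ge0.
rewrite ler_pdivlMl//.
apply: le_trans (mean_route_length (sum_cfg_weight (model p p_gt0))).
(* From N <= C p and p >= 1 follows 1 + c N <= (1 + c |C|) p, so the linear growth of the mean route
   length cancels that of N. *)
have p1 : 1 <= p%:R :> R by rewrite ler1n.
have -> : (1 + c * (N p)%:R) * (2 * beta_spread alpha / (1 + c * `|C|)) =
  2 * beta_spread alpha * ((1 + c * (N p)%:R) / (1 + c * `|C|)) by ring.
apply: ler_wpM2l; first by rewrite mulr_ge0// ltW.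
rewrite ler_pdivrMr// mulrDr mulr1; apply: lerD => //.
rewrite mulrCA ler_wpM2l// mulrC (le_trans (N_le p p0p))//.
by rewrite ler_wpM2r// ler_norm.
Qed.
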